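(* Let $R$ be a ring with $\mathrm{Gwgl.dim}\,R<\infty$. Then every finitely presented Gorenstein flat $R$-module is projectively coresolved Gorenstein flat (PGF), hence also Gorenstein projective.
   Context: Rings are associative with unit; modules are left modules unless stated otherwise. - An acyclic (exact) complex $\mathbf F$ of flat $R$-modules (indexed by $\mathbb Z$) is F-totally acyclic if $I\otimes_R\mathbf F$ is acyclic for every injective right $R$-module $I$. An $R$-module is Gorenstein flat if it is a syzygy (i.e. the image of one of the differentials) of such a complex. - An $R$-module is PGF (projectively coresolved Gorenstein flat) if it is a syzygy of an acyclic complex $\mathbf P$ of projective $R$-modules such that $I\otimes_R\mathbf P$ is acyclic for every injective right $R$-module $I$. - An $R$-module is Gorenstein projective if it is a syzygy of an acyclic complex $\mathbf P$ of projective $R$-modules such that $\mathrm{Hom}_R(\mathbf P,Q)$ is acyclic for every projective $R$-module $Q$. - The Gorenstein flat dimension $\mathrm{Gfd}_RM$ of an $R$-module $M$ is the minimal length of a resolution of $M$ by Gorenstein flat modules ($\infty$ if no finite one exists). - $\mathrm{Gwgl.dim}\,R=\sup\{\mathrm{Gfd}_RM : M \text{ an } R\text{-module}\}$. *)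

(* Defs.v *)
(* MathComp, with classical reasoning from mathcomp.classical.boolp. *)
From HB Require Import structures.
From mathcomp Require Import all_boot all_order all_algebra.
From mathcomp Require Import generic_quotient ring_quotient freeg boolp.

Set Implicit Arguments.
Unset Strict Implicit.
Unset Printing Implicit Defensive.

Import GRing.Theory.
Local Open Scope ring_scope.
Local Open Scope quotient_scope.

(* Rings are [pzRingType], so the zero ring is allowed. A left R-module is an
   [lmodType R]; a right R-module is an [lmodType R^c], i.e. a left module over
   the opposite ring: for a in a right module, a.r is (r : R^c) *: a. *)

Section Tensor.
Variable R : pzRingType.

Section Object.
Variables (A : lmodType R^c) (M : lmodType R).

(* The subgroup of the free abelian group on A * M that defines A (x)_R M. *)
Inductive tensor_rel : {freeg (A * M)} -> Prop :=
| tensor_rel0 : tensor_rel 0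
| tensor_relB x y : tensor_rel x -> tensor_rel y -> tensor_rel (x - y)
| tensor_relDl a a' m :
    tensor_rel (<< (a + a', m) >> - << (a, m) >> - << (a', m) >>)
| tensor_relDr a m m' :
    tensor_rel (<< (a, m + m') >> - << (a, m) >> - << (a, m') >>)
| tensor_relZ (r : R) a m :
    tensor_rel (<< ((r : R^c) *: a, m) >> - << (a, r *: m) >>).

Definition tensor_pred : {pred {freeg (A * M)}} := fun x => `[< tensor_rel x >].

Lemma tensor_pred_zmod : zmod_closed tensor_pred.
Proof.
split; first by apply/asboolP; exact: tensor_rel0.
by move=> x y /asboolP hx /asboolP hy; apply/asboolP; exact: tensor_relB.
Qed.

HB.instance Definition _ :=
  GRing.isZmodClosed.Build {freeg (A * M)} tensor_pred tensor_pred_zmod.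

Definition tensor :=
  Quotient.quot (GRing.ZmodClosed.clone {freeg (A * M)} tensor_pred _).

HB.instance Definition _ := GRing.Zmodule.on tensor.
HB.instance Definition _ := Quotient.on tensor.
HB.instance Definition _ : EqQuotient _ _ tensor := EqQuotient.on tensor.

Definition tens (a : A) (m : M) : tensor := \pi_tensor << (a, m) >>.

End Object.

Definition tensor_map (A B : lmodType R^c) (M N : lmodType R)
    (f : {linear A -> B}) (g : {linear M -> N}) (x : tensor A M) : tensor B N :=
  \pi_(tensor B N) (fglift (fun k => << (f k.1, g k.2) >>) (repr x)).

HB.instance Definition _ (K : choiceType) (V : lmodType int) (h : K -> V) :=
  GRing.isAdditive.Build {freeg K / int} V (fglift h) (lift_is_additive h).

Lemma pi_tensorP (A : lmodType R^c) (M : lmodType R) (x y : {freeg (A * M)}) :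
  \pi_(tensor A M) x = \pi_(tensor A M) y <-> tensor_rel (x - y).
Proof.
have E := @Quotient.idealrBE _
  (GRing.ZmodClosed.clone {freeg (A * M)} (@tensor_pred A M) _) x y.
split; first by move=> /eqP; rewrite -E => /asboolP.
by move=> h; apply/eqP; rewrite -E; apply/asboolP.
Qed.

(* [tensor_map] does not depend on the representative chosen by [repr]. *)
Lemma tensor_map_pi (A B : lmodType R^c) (M N : lmodType R)
    (f : {linear A -> B}) (g : {linear M -> N}) (x : {freeg (A * M)}) :
  tensor_map f g (\pi_(tensor A M) x) =
  \pi_(tensor B N) (fglift (fun k => << (f k.1, g k.2) >>) x).
Proof.
apply/pi_tensorP; rewrite -raddfB.
have : tensor_rel (repr (\pi_(tensor A M) x) - x).
  by apply/pi_tensorP; rewrite reprK.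
elim=> [|u v _ hu _ hv|a a' m|a m m'|r a m].
- by rewrite raddf0; exact: tensor_rel0.
- by rewrite raddfB; exact: tensor_relB.
- by rewrite !raddfB /= !liftU !scale1r /= raddfD; exact: tensor_relDl.
- by rewrite !raddfB /= !liftU !scale1r /= raddfD; exact: tensor_relDr.
- by rewrite !raddfB /= !liftU !scale1r /= !linearZ; exact: tensor_relZ.
Qed.

Lemma tensor_map_tens (A B : lmodType R^c) (M N : lmodType R)
    (f : {linear A -> B}) (g : {linear M -> N}) (a : A) (m : M) :
  tensor_map f g (tens a m) = tens (f a) (g m).
Proof. by rewrite tensor_map_pi liftU scale1r. Qed.

End Tensor.

(* B -f-> C -g-> D is exact at C; in particular g \o f = 0. *)
Definition exact_at (B C D : zmodType) (f : B -> C) (g : C -> D) : Prop :=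
  forall y : C, g y = 0 <-> exists x : B, f x = y.

Definition injective_module (R : pzRingType) (I : lmodType R) : Prop :=
  forall (A B : lmodType R) (j : {linear A -> B}) (f : {linear A -> I}),
    injective j -> exists g : {linear B -> I}, forall x, g (j x) = f x.

Section Modules.
Variable R : pzRingType.

Definition projective_module (P : lmodType R) : Prop :=
  forall (A B : lmodType R) (q : {linear A -> B}) (f : {linear P -> B}),
    (forall y, exists x, q x = y) ->
    exists g : {linear P -> A}, forall x, q (g x) = f x.

(* The functor - (x)_R M is exact. *)
Definition flat_module (M : lmodType R) : Prop :=
  forall (A B C : lmodType R^c) (f : {linear A -> B}) (g : {linear B -> C}),
    exact_at f g ->
    exact_at (tensor_map f (idfun : {linear M -> M}))
             (tensor_map g (idfun : {linear M -> M})).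

Definition finitely_presented (M : lmodType R) : Prop :=
  exists (m n : nat) (f : {linear 'rV[R]_m -> 'rV[R]_n})
         (g : {linear 'rV[R]_n -> M}),
    exact_at f g /\ (forall y, exists x, g x = y).

(* Homological indexing; the differential out of degree i + 1 is [diff i]. *)
Record complex := Complex {
  term :> int -> lmodType R;
  diff : forall i : int, {linear term (i + 1) -> term i};
  diffK : forall i x, diff i (diff (i + 1) x) = 0
}.

Definition acyclic (X : complex) : Prop :=
  forall i : int, exact_at (diff X (i + 1)) (diff X i).

Definition tensor_acyclic (I : lmodType R^c) (X : complex) : Prop :=
  forall i : int,
    exact_at (tensor_map (idfun : {linear I -> I}) (diff X (i + 1)))
             (tensor_map (idfun : {linear I -> I}) (diff X i)).

(* Exactness of Hom(X i, Q) -> Hom(X (i+1), Q) -> Hom(X (i+1+1), Q), the maps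
   being precomposition with the differentials. *)
Definition hom_acyclic (X : complex) (Q : lmodType R) : Prop :=
  forall (i : int) (f : {linear X (i + 1) -> Q}),
    (forall x, f (diff X (i + 1) x) = 0) <->
    exists g : {linear X i -> Q}, forall x, g (diff X i x) = f x.

(* M is isomorphic, via f, to the image of one of the differentials of X. *)
Definition is_syzygy (M : lmodType R) (X : complex) : Prop :=
  exists (i : int) (f : {linear M -> X i}), injective f /\
    forall y, (exists m, f m = y) <-> (exists x, diff X i x = y).

Definition F_totally_acyclic (X : complex) : Prop :=
  [/\ forall i, flat_module (X i), acyclic X &
      forall I : lmodType R^c, injective_module I -> tensor_acyclic I X].

Definition Gorenstein_flat (M : lmodType R) : Prop :=
  exists X : complex, F_totally_acyclic X /\ is_syzygy M X.

Definition PGF (M : lmodType R) : Prop :=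
  exists X : complex,
    [/\ forall i, projective_module (X i), acyclic X,
        forall I : lmodType R^c, injective_module I -> tensor_acyclic I X &
        is_syzygy M X].

Definition Gorenstein_projective (M : lmodType R) : Prop :=
  exists X : complex,
    [/\ forall i, projective_module (X i), acyclic X,
        forall Q : lmodType R, projective_module Q -> hom_acyclic X Q &
        is_syzygy M X].

(* 0 -> G n -> ... -> G 1 -> G 0 -> M -> 0, continued by zero modules. *)
Definition GF_resolution (M : lmodType R) (n : nat) : Prop :=
  exists (G : nat -> lmodType R) (d : forall k, {linear G k.+1 -> G k})
         (e : {linear G 0%N -> M}),
    [/\ forall k, (k <= n)%N -> Gorenstein_flat (G k),
        forall k, (n < k)%N -> forall x : G k, x = 0,
        forall y, exists x, e x = y,
        exact_at (d 0%N) e &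
        forall k, exact_at (d k.+1) (d k)].

End Modules.

(* Dimensions take values in [option nat], with None standing for infinity. *)
Definition dim_le (d e : option nat) : Prop :=
  match d, e with
  | _, None => True
  | None, Some _ => False
  | Some m, Some n => (m <= n)%N
  end.

Definition least (P : nat -> Prop) : option nat :=
  if pselect (exists n, `[< P n >]) is left exP then Some (ex_minn exP)
  else None.

Definition Gfd (R : pzRingType) (M : lmodType R) : option nat :=
  least (GF_resolution M).

(* The supremum of all Gfd M, as their least upper bound. *)
Definition Gwgldim (R : pzRingType) : option nat :=
  least (fun n => forall M : lmodType R, dim_le (Gfd M) (Some n)).

(* Main.v *)
Require Import Defs.
From HB Require Import structures.
From mathcomp Require Import all_boot all_order all_algebra.
From mathcomp Require Import generic_quotient ring_quotient freeg boolp classical_sets.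
From mathcomp Require Import zify.

(**
Let M be finitely presented with an F-totally acyclic flat complex around it.
The left half of a complete projective resolution of M is an arbitrary
projective resolution: comparing it with the flat one shows that tensoring with
injective right modules keeps it exact. For the right half, M has a preenvelope
j : M -> N by a finitely generated free module. Its existence comes from a
uniformity principle: exactness of J (x) F for the single injective right module
J = prod_X Hom(Y, Q/Z), Y flat, evaluated at the tautological element indexed by
the set X of all solutions of a linear system over Hom(Y, Q/Z), gives finitely
many equations valid for all solutions at once. An injective right module J
keeps j injective, and N/M inherits the hypotheses on M up to a flat direct
summand, so the construction iterates; this makes M a PGF module.

For Hom-acyclicity one needs Ext^i(M, Q) = 0 for i > 0 and Q projective. The
uniformity principle turns Tor_i(Q^+, M) = 0 into implications between finite
linear systems over Q; these persist in the bidual Q^{++} and in Q^{++}/Q. They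
give Ext^1(M, Y) = 0 and Ext^i(M, Y^{++}) = 0 for i > 0, and dimension shifting
along 0 -> Y -> Y^{++} -> Y^{++}/Y -> 0 does the rest.
*)

Set Implicit Arguments.
Unset Strict Implicit.
Unset Printing Implicit Defensive.

Import Order.TTheory GRing.Theory Num.Theory.
Local Open Scope ring_scope.
Local Open Scope quotient_scope.

(** The bidual of a flat module need not be flat, so the dimension shift cannot stay among flat
    modules. It carries instead implications between finite systems, in the form [sequent]: whenever
    [pi y = 0], the family [rho y] lies in the image of [la]. Taking characters turns such an
    implication into a transposed one, and taking them twice returns it.

    Exactness against one injective module certifies the vanishing of one element at a time, with
    coefficients that depend on this element. A product with one coordinate for each solution forces
    a single choice of coefficients; flatness of Y is what keeps the product injective.

    On the right, replacing flat terms by free ones leaves a flat kernel Z in front of the module C,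
    and Z need not split off. The preenvelope therefore has two blocks: one through which the map
    from C to the first flat term factors, and one through which a map from C to Z factors. *)

Definition mk_additive (U V : zmodType) (f : U -> V) (h : zmod_morphism f) :
    {additive U -> V} :=
  HB.pack_for {additive U -> V} f (GRing.isZmodMorphism.Build U V f h).

Definition mk_linear (R : pzRingType) (U V : lmodType R) (f : U -> V)
    (h : linear f) : {linear U -> V} :=
  HB.pack_for {linear U -> V} f (GRing.isLinear.Build R U V _ f h).

(** * Characters of abelian groups *)

Definition integral_rat : {pred rat} := fun x => x \is a Num.int.

Lemma integral_rat_zmod : zmod_closed integral_rat.
Proof.
split; first exact: Num.Theory.int_num0.
by move=> x y hx hy; rewrite unfold_in; apply: rpredB.
Qed.

HB.instance Definition _ :=
  GRing.isZmodClosed.Build rat integral_rat integral_rat_zmod.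

Definition QmodZ := Quotient.quot (GRing.ZmodClosed.clone rat integral_rat _).

HB.instance Definition _ := GRing.Zmodule.on QmodZ.
HB.instance Definition _ := Quotient.on QmodZ.
HB.instance Definition _ : EqQuotient _ _ QmodZ := EqQuotient.on QmodZ.
HB.instance Definition _ := ZmodQuotient.on QmodZ.

Definition ratQZ : rat -> QmodZ := \pi_QmodZ.

Lemma ratQZB : zmod_morphism ratQZ.
Proof. exact: raddfB. Qed.
HB.instance Definition _ := GRing.isZmodMorphism.Build rat QmodZ ratQZ ratQZB.

Lemma ratQZ_eq0 x : ratQZ x = 0 -> x \is a Num.int.
Proof.
move=> h; have := @Quotient.idealrBE _ (GRing.ZmodClosed.clone rat integral_rat _) x 0.
rewrite subr0 => E; rewrite -[_ \is a _]/(x \in integral_rat) E -/ratQZ h.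
by apply/eqP; rewrite -[RHS]/(ratQZ 0) raddf0.
Qed.

Lemma ratQZ_int (k : int) : ratQZ k%:~R = 0.
Proof.
apply/eqP; rewrite -(raddf0 ratQZ).
have := @Quotient.idealrBE _ (GRing.ZmodClosed.clone rat integral_rat _) k%:~R 0.
by move=> <-; rewrite subr0; apply: Num.Theory.intr_int.
Qed.

Lemma QmodZ_divisible (n : nat) (d : QmodZ) :
  (0 < n)%N -> exists d', d' *+ n = d.
Proof.
move=> n_gt0; elim/quotW: d => x; exists (ratQZ (x / n%:R)).
by rewrite -raddfMn /= -(mulr_natr (x / _)) divfK // pnatr_eq0 -lt0n.
Qed.

(** The integers [k] with [P (x *~ k)] form a subgroup of Z, which is zero or generated by its least
    positive element. *)
Lemma order_mod (G : zmodType) (P : G -> Prop) (x : G) :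
    P 0 -> (forall y z, P y -> P z -> P (y - z)) ->
  (forall k : int, P (x *~ k) -> k = 0) \/
  exists n : nat, [/\ (0 < n)%N, P (x *+ n) &
    forall k : int, P (x *~ k) -> exists q : int, k = q * n%:Z].
Proof.
move=> P0 PB.
have PN y : P y -> P (- y) by move=> Py; rewrite -sub0r; apply: PB.
have PD y z : P y -> P z -> P (y + z).
  by move=> Py Pz; rewrite -[z]opprK; apply: PB => //; apply: PN.
have PMz y k : P y -> P (y *~ k).
  move=> Py; elim/int_ind: k => [|n IH|n IH]; rewrite ?mulr0z //.
    by rewrite -addn1 PoszD mulrzDr; apply: PD.
  by rewrite -addn1 PoszD opprD mulrzDr; apply: PB.
have [ex|nex] := pselect (exists n : nat, `[< (0 < n)%N /\ P (x *+ n) >]).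
  right; case: (ex_minnP ex) => n /asboolP [n0 Pn] minn; exists n; split=> // k Pk.
  exists (k %/ n)%Z; rewrite {1}(divz_eq k n).
  suff -> : (k %% n)%Z = 0 by rewrite addr0.
  have : P (x *~ (k %% n)%Z).
    rewrite /modz mulrzBr; apply: PB => //.
    by rewrite mulrC mulrzA; apply: PMz.
  have /andP[] : 0 <= (k %% n)%Z < n%:Z.
    by rewrite modz_ge0 ?ltz_mod //; lia.
  case: (k %% n)%Z => // r _ rn Pr; case: (posnP r) => [->//|r0].
  have : (n <= r)%N by apply: minn; apply/asboolP.
  by rewrite leqNgt -ltz_nat rn.
left=> -[] n.
  case: (posnP n) => [->//|n0 Pn]; case: nex; exists n; exact/asboolP.
rewrite NegzE => /PN; rewrite mulrNz opprK => Pn; case: nex; exists n.+1; exact/asboolP.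
Qed.

Section Extension.
Variables (S G : zmodType) (u : {additive S -> G}) (f : {additive S -> QmodZ}).
Hypothesis ker_uf : forall x, u x = 0 -> f x = 0.

(** A partial extension of [f] along [u], encoded by its graph: the third clause makes the graph
    single-valued, the fourth prescribes the values on the image of [u]. *)
Let good (A : set (G * QmodZ)) :=
  [/\ A 0, forall p q, A p -> A q -> A (p - q),
      forall d, A (0, d) -> d = 0 & forall x, A (u x, f x)].

(** [QmodZ] is an injective abelian group because it is divisible: a partial extension that misses
    an element can be enlarged, so a maximal one is total. *)
Lemma character_ext : exists F : {additive G -> QmodZ}, forall x, F (u x) = f x.
Proof.
have [|A [PA Amax]] :=
    @Zorn_bigcup (G * QmodZ)%type (fun A => A = set0 \/ good A).
  move=> F FP Ftot.
  have [[A FA gA]|noA] := pselect (exists2 A, F A & good A); last first.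
    left; rewrite -subset0 => p [B FB Bp].
    by have [B0|gB] := FP _ FB; [rewrite B0 in Bp | case: noA; exists B].
  right; split.
  - by exists A => //; case: gA.
  - move=> p q [B FB Bp] [C FC Cq].
    have gd E e : F E -> E e -> good E.
      by move=> FE Ee; have [E0|//] := FP _ FE; rewrite E0 in Ee.
    have [BC|CB] := Ftot _ _ FB FC.
      by exists C => //; have [_ + _ _] := gd _ _ FC Cq; apply=> //; apply: BC.
    by exists B => //; have [_ + _ _] := gd _ _ FB Bp; apply=> //; apply: CB.
  - move=> d [B FB Bd]; have [B0|[_ _ + _]] := FP _ FB; last exact.
    by rewrite B0 in Bd.
  - by move=> x; exists A => //; case: gA.
have [A0|[A0 AB Af Au]] := PA.
  exfalso; pose B p := exists x, p = (u x, f x).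
  apply: (Amax B); last first.
    right; split.
    - by exists 0; rewrite !raddf0.
    - by move=> _ _ [x ->] [y ->]; exists (x - y); rewrite !raddfB.
    - by move=> d [x [/esym/ker_uf <- ->]].
    - by move=> x; exists x.
  rewrite A0; split=> // /(_ (u 0, f 0)); apply; by exists 0.
have AN p : A p -> A (- p) by move=> ?; rewrite -sub0r; apply: AB.
have AD p q : A p -> A q -> A (p + q).
  by move=> ? ?; rewrite -[q]opprK; apply: AB => //; apply: AN.
have AMn p n : A p -> A (p *+ n).
  by move=> Ap; elim: n => [|n IH]; rewrite ?mulr0n // mulrS; apply: AD.
have AMz p k : A p -> A (p *~ k).
  by case: k => n Ap; [apply: AMn | rewrite NegzE mulrNz; apply/AN/AMn].
have pMz (x : G) (d : QmodZ) k : (x, d) *~ k = (x *~ k, d *~ k).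
  have pMn n : (x, d) *+ n = (x *+ n, d *+ n).
    by elim: n => [//|n IH]; rewrite !mulrS IH.
  by case: k => n; rewrite ?NegzE ?mulrNz -?pmulrn pMn.
have tot x : exists d, A (x, d).
  apply: contrapT => nx.
  pose P y := exists d, A (y, d).
  (* The value at [x] must agree with those already given to multiples of [x]. If only the zero
     multiple has one, 0 will do; otherwise the value [e] at the generating multiple [x *+ n] is
     divided by [n]. *)
  have [d0 d0P] : exists d0, forall k d, A (x *~ k, d) -> d = d0 *~ k.
    have [||xfree|[n [n0 [e Ae] gen]]] := @order_mod G P x.
    - by exists 0.
    - by move=> y z [d Ad] [e Ae]; exists (d - e); apply: (AB (y, d) (z, e)).
    - exists 0 => k d Ad; have k0 : k = 0 by apply: xfree; exists d.
      by rewrite mul0rz; apply: Af; rewrite k0 in Ad.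
    - have [d0 d0n] := QmodZ_divisible e n0; exists d0 => k d Ad.
      have [|q kq] := gen k; first by exists d.
      have Aq : A (x *~ k, e *~ q).
        by have := AMz _ q Ae; rewrite pMz kq mulrC mulrzA.
      have : A (x *~ k - x *~ k, d - e *~ q) := AB _ _ Ad Aq.
      by rewrite subrr => /Af/subr0_eq ->; rewrite -d0n kq mulrC mulrzA.
  pose B (p : G * QmodZ) := exists k, A (p.1 - x *~ k, p.2 - d0 *~ k).
  apply: (Amax B); last first.
    right; split.
    - by exists 0; rewrite !mulr0z !subr0.
    - move=> p q [k Ap] [l Aq]; exists (k - l).
      have : A (_ - _, _ - _) := AB _ _ Ap Aq.
      have E (V : zmodType) (a b c e : V) : a - b - (c - e) = a - c - (b - e).
        by rewrite !opprD !opprK addrACA.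
      by rewrite /= !mulrzBr [X in A (X, _)]E [X in A (_, X)]E.
    - move=> d [k] /=; rewrite sub0r -mulrNz => /d0P.
      by rewrite mulrNz => /eqP; rewrite subr_eq addNr => /eqP.
    - by move=> y; exists 0; rewrite !mulr0z !subr0; apply: Au.
  split; last first.
    by move=> BA; apply: nx; exists d0; apply: BA; exists 1; rewrite /= !subrr.
  by move=> p Ap; exists 0; rewrite !mulr0z !subr0 -surjective_pairing.
pose F x := projT1 (cid (tot x)).
have FA x : A (x, F x) := projT2 (cid (tot x)).
have Funiq x d : A (x, d) -> F x = d.
  move=> Ad; apply/subr0_eq/Af; have := AB _ _ (FA x) Ad.
  by rewrite -[_ - _]/(_ - _, _ - _) subrr.
have FB : zmod_morphism F.
  by move=> x y; apply: Funiq; apply: (AB (x, _) (y, _)).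
exists (mk_additive FB) => x /=.
exact: Funiq.
Qed.
End Extension.

(** [QmodZ] is a cogenerator: a character of the subgroup generated by [x] and the image of [u] is
    prescribed and then extended to [G]. *)
Lemma character_sep (S G : zmodType) (u : {additive S -> G}) (x : G) :
  ~ (exists s, u s = x) ->
  exists F : {additive G -> QmodZ}, (forall s, F (u s) = 0) /\ F x <> 0.
Proof.
move=> nx; pose P y := exists s, u s = y.
(* The value at [x] is 1/n for [n] the order of [x] modulo the image of [u], where [n] exceeds 1
   because [x] is not in the image; it is 1/2 if the order is infinite. *)
have [d [d0 dP]] : exists d : QmodZ, d <> 0 /\ forall k, P (x *~ k) -> d *~ k = 0.
  have half (n : nat) : (1 < n)%N -> ratQZ (n%:R^-1) <> 0.
    move=> n1 /ratQZ_eq0/intrP [k] /(congr1 ( *%R n%:R)).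
    have n0 : n%:R != 0 :> rat by rewrite pnatr_eq0; lia.
    rewrite mulfV // -[n%:R]/(n%:Z%:~R) -rmorphM /= => /(@intr_inj rat 1) h.
    have : absz (n%:Z * k) = 1%N by rewrite -h.
    by rewrite abszM /= => /eqP; rewrite muln_eq1; lia.
  have [||xfree|[n [n0 Pn gen]]] := @order_mod G P x.
  - by exists 0; rewrite raddf0.
  - by move=> _ _ [s <-] [t <-]; exists (s - t); rewrite raddfB.
  - by exists (ratQZ (2%:R^-1)); split=> [|k /xfree ->]; [exact: half | rewrite mulr0z].
  - exists (ratQZ (n%:R^-1)); split=> [|k /gen [q ->]].
      apply: half; case: n n0 Pn gen => [|[|n]] // _ Pn; by case: nx.
    rewrite mulrC mulrzA -pmulrn -raddfMn /= -(mulr_natr (n%:R^-1 : rat)).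
    rewrite mulVf ?(ratQZ_int 1) ?mul0rz //.
    by rewrite pnatr_eq0; lia.
pose v (p : S * int) := u p.1 + x *~ p.2.
pose f (p : S * int) := d *~ p.2.
have vB : zmod_morphism v.
  by move=> p q; rewrite /v raddfB /= mulrzBr opprD addrACA.
have fB : zmod_morphism f by move=> p q; rewrite /f mulrzBr.
have [|F FP] := @character_ext _ _ (mk_additive vB) (mk_additive fB).
  move=> [s k] /= /eqP; rewrite /v /= addrC addr_eq0 => /eqP h; apply: dP; exists (- s).
  by rewrite raddfN h.
exists F; split=> [s|]; first by have := FP (s, 0); rewrite /= /v /f /= !mulr0z addr0.
by have := FP (0, 1); rewrite /= /v /f /= raddf0 add0r => ->.
Qed.

Lemma sum_delta (I : finType) (V W : zmodType) (G : I -> V -> W) (j : I) (v : V) :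
  (forall i, G i 0 = 0) -> \sum_i G i (if i == j then v else 0) = G j v.
Proof.
move=> G0; rewrite (bigD1 j) //= eqxx big1 ?addr0 // => i ne.
by rewrite (negPf ne) G0.
Qed.

Lemma ffun_character (I : finType) (V : zmodType)
    (F : {additive {ffun I -> V} -> QmodZ}) :
  exists chi : I -> V -> QmodZ,
    (forall i, zmod_morphism (chi i)) /\ (forall h, F h = \sum_i chi i (h i)).
Proof.
pose dl i (v : V) : {ffun I -> V} := [ffun i' => if i' == i then v else 0].
have dlE (h : {ffun I -> V}) : h = \sum_i dl i (h i).
  apply/ffunP => i; rewrite sum_ffunE (bigD1 i) //= ffunE eqxx big1 ?addr0 //.
  by move=> i' ne; rewrite ffunE eq_sym (negPf ne).
exists (fun i v => F (dl i v)); split=> [i v v'|h]; last by rewrite {1}(dlE h) raddf_sum.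
rewrite -raddfB; congr (F _); apply/ffunP => i'; rewrite !ffunE.
by case: eqP => //; rewrite subrr.
Qed.

(** * Kernels, cokernels and free modules *)

Section Kernel.
Variables (R : pzRingType) (V W : lmodType R) (f : {linear V -> W}).

Definition ker_pred : {pred V} := fun x => f x == 0.

Lemma ker_pred_submod : submod_closed ker_pred.
Proof.
split; first by rewrite unfold_in raddf0.
by move=> a x y /eqP fx /eqP fy; rewrite unfold_in linearP fx fy scaler0 addr0.
Qed.

HB.instance Definition _ := GRing.isSubmodClosed.Build R V ker_pred ker_pred_submod.

Record ker_type := KerType { ker_val :> V; ker_valP : ker_val \in ker_pred }.
HB.instance Definition _ := [isSub for ker_val].
HB.instance Definition _ := [Choice of ker_type by <:].
HB.instance Definition _ := [SubChoice_isSubLmodule of ker_type by <:].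

Lemma ker_exists : exists (K : lmodType R) (k : {linear K -> V}),
  injective k /\ exact_at k f.
Proof.
exists ker_type, (val : {linear ker_type -> V}); split; first exact: val_inj.
move=> x; split=> [fx|[y <-]]; last exact/eqP/(ker_valP y).
by exists (@KerType x (introT eqP fx)).
Qed.

End Kernel.

Section Cokernel.
Variables (R : pzRingType) (U V : lmodType R) (f : {linear U -> V}).

Definition im_pred : {pred V} := fun y => `[< exists x, f x = y >].

Lemma im_pred_zmod : zmod_closed im_pred.
Proof.
split; first by apply/asboolP; exists 0; rewrite raddf0.
move=> _ _ /asboolP[x <-] /asboolP[y <-].
by apply/asboolP; exists (x - y); rewrite raddfB.
Qed.

HB.instance Definition _ := GRing.isZmodClosed.Build V im_pred im_pred_zmod.

Definition coker := Quotient.quot (GRing.ZmodClosed.clone V im_pred _).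

HB.instance Definition _ := GRing.Zmodule.on coker.
HB.instance Definition _ := Quotient.on coker.
HB.instance Definition _ : EqQuotient _ _ coker := EqQuotient.on coker.
HB.instance Definition _ := ZmodQuotient.on coker.

Definition coker_pi (x : V) : coker := \pi_coker x.

Lemma coker_piB : zmod_morphism coker_pi. Proof. exact: raddfB. Qed.
HB.instance Definition _ := GRing.isZmodMorphism.Build V coker coker_pi coker_piB.

Lemma coker_repr (x : coker) : coker_pi (repr x) = x.
Proof. exact: reprK. Qed.

Lemma coker_pi_eq x y : coker_pi x = coker_pi y <-> exists z, f z = x - y.
Proof.
have E := @Quotient.idealrBE _ (GRing.ZmodClosed.clone V im_pred _) x y.
split; first by move=> /eqP; rewrite -E => /asboolP.
by move=> h; apply/eqP; rewrite -E; apply/asboolP.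
Qed.

Definition coker_scale (a : R) (x : coker) : coker := coker_pi (a *: repr x).

Lemma coker_scale_pi a x : coker_scale a (coker_pi x) = coker_pi (a *: x).
Proof.
apply/coker_pi_eq; have [z fz] : exists z, f z = repr (coker_pi x) - x.
  by apply/coker_pi_eq; rewrite coker_repr.
by exists (a *: z); rewrite linearZ /= fz scalerBr.
Qed.

Lemma coker_scaleA a b x : coker_scale a (coker_scale b x) = coker_scale (a * b) x.
Proof.
by rewrite -(coker_repr x) coker_scale_pi coker_scale_pi coker_scale_pi scalerA.
Qed.

Lemma coker_scale1 : left_id 1 coker_scale.
Proof. by move=> x; rewrite -(coker_repr x) coker_scale_pi scale1r. Qed.

Lemma coker_scaleDr : right_distributive coker_scale +%R.
Proof.
move=> a x y; rewrite -(coker_repr x) -(coker_repr y) -raddfD.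
by rewrite !coker_scale_pi scalerDr raddfD.
Qed.

Lemma coker_scaleDl x : {morph coker_scale^~ x : a b / a + b}.
Proof.
by move=> a b; rewrite -(coker_repr x) !coker_scale_pi scalerDl raddfD.
Qed.

HB.instance Definition _ := GRing.Zmodule_isLmodule.Build R coker
  coker_scaleA coker_scale1 coker_scaleDr coker_scaleDl.

Lemma coker_exists : exists (C : lmodType R) (q : {linear V -> C}),
  (forall y, exists x, q x = y) /\ exact_at f q.
Proof.
have q_lin : linear coker_pi.
  move=> a x y; rewrite raddfD; congr (_ + _); exact/esym/coker_scale_pi.
exists coker, (mk_linear q_lin); split=> [y|y].
  by exists (repr y); apply: coker_repr.
by rewrite /= -[in X in _ <-> X](subr0 y) -coker_pi_eq raddf0.
Qed.

End Cokernel.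

Lemma descend (R : pzRingType) (A B C : lmodType R) (q : {linear A -> B})
    (f : {linear A -> C}) :
  (forall y, exists x, q x = y) -> (forall x, q x = 0 -> f x = 0) ->
  exists g : {linear B -> C}, forall x, g (q x) = f x.
Proof.
move=> q_surj kerqf; pose s y := projT1 (cid (q_surj y)).
have qs y : q (s y) = y := projT2 (cid (q_surj y)).
have gq x : f (s (q x)) = f x.
  by apply/subr0_eq; rewrite -raddfB; apply: kerqf; rewrite raddfB /= qs subrr.
have g_lin : linear (f \o s).
  move=> a x y; rewrite /= -linearP -[in RHS]gq; congr (f (s _)).
  by rewrite linearP /= !qs.
by exists (mk_linear g_lin) => x /=.
Qed.

(** [h] is the projection to A modulo its kernel followed by an injection; [f] descends along the
    former and extends along the latter. *)
Lemma injective_factor (R : pzRingType) (A B I : lmodType R) (h : {linear A -> B})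
    (f : {linear A -> I}) :
  injective_module I -> (forall x, h x = 0 -> f x = 0) ->
  exists g : {linear B -> I}, forall x, g (h x) = f x.
Proof.
move=> I_inj kerhf; have [K [k [_ k_ker]]] := ker_exists h.
have [C [q [q_surj q_coker]]] := coker_exists k.
have kerq x : q x = 0 -> h x = 0 by move=> /q_coker/k_ker.
have [hq hqE] := descend q_surj kerq.
have [fq fqE] := descend q_surj (fun x qx => kerhf x (kerq x qx)).
have [|g gE] := I_inj _ _ hq fq; last by exists g => x; rewrite -hqE gE.
move=> x y; have [x' <-] := q_surj x; have [y' <-] := q_surj y.
rewrite !hqE => hxy; apply/subr0_eq; rewrite -raddfB; apply/q_coker/k_ker.
by rewrite raddfB /= hxy subrr.
Qed.

Section FreeModule.
Variables (R : pzRingType) (K : choiceType).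

Definition finsupp (f : K -> R) := exists s : seq K, forall x, x \notin s -> f x = 0.

(** The support bound is a mere existence statement, so elements with equal values are equal. *)
Record free_module := FreeModule { free_val :> K -> R; free_valP : finsupp free_val }.

Lemma free_module_ext (f g : free_module) : (forall x, f x = g x) -> f = g.
Proof.
case: f g => [f hf] [g hg] /= /funext fg; move: hf hg; rewrite fg => hf hg.
by congr FreeModule; apply: Prop_irrelevance.
Qed.

HB.instance Definition _ := gen_eqMixin free_module.
HB.instance Definition _ := gen_choiceMixin free_module.

Lemma free_zeroP : finsupp (fun _ => 0). Proof. by exists [::]. Qed.
Lemma free_oppP (f : free_module) : finsupp (fun x => - f x).
Proof. by have [s fs] := free_valP f; exists s => x /fs ->; rewrite oppr0. Qed.
Lemma free_addP (f g : free_module) : finsupp (fun x => f x + g x).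
Proof.
have [s fs] := free_valP f; have [t gt] := free_valP g; exists (s ++ t) => x.
by rewrite mem_cat negb_or => /andP[/fs -> /gt ->]; rewrite addr0.
Qed.
Lemma free_scaleP a (f : free_module) : finsupp (fun x => a * f x).
Proof. by have [s fs] := free_valP f; exists s => x /fs ->; rewrite mulr0. Qed.

Let zero := FreeModule free_zeroP.
Let opp f := FreeModule (free_oppP f).
Let add f g := FreeModule (free_addP f g).
Let scale a f := FreeModule (free_scaleP a f).

Fact free_addA : associative add.
Proof. by move=> f g h; apply: free_module_ext => x; apply: addrA. Qed.
Fact free_addC : commutative add.
Proof. by move=> f g; apply: free_module_ext => x; apply: addrC. Qed.
Fact free_add0 : left_id zero add.
Proof. by move=> f; apply: free_module_ext => x; apply: add0r. Qed.
Fact free_addN : left_inverse zero opp add.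
Proof. by move=> f; apply: free_module_ext => x; apply: addNr. Qed.

HB.instance Definition _ :=
  GRing.isZmodule.Build free_module free_addA free_addC free_add0 free_addN.

Fact free_scaleA a b f : scale a (scale b f) = scale (a * b) f.
Proof. by apply: free_module_ext => x; apply: mulrA. Qed.
Fact free_scale1 : left_id 1 scale.
Proof. by move=> f; apply: free_module_ext => x; apply: mul1r. Qed.
Fact free_scaleDr : right_distributive scale +%R.
Proof. by move=> a f g; apply: free_module_ext => x; apply: mulrDr. Qed.
Fact free_scaleDl f : {morph scale^~ f : a b / a + b}.
Proof. by move=> a b; apply: free_module_ext => x; apply: mulrDl. Qed.

HB.instance Definition _ := GRing.Zmodule_isLmodule.Build R free_module
  free_scaleA free_scale1 free_scaleDr free_scaleDl.

Lemma free_unitP k : finsupp (fun x => (x == k)%:R).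
Proof. by exists [:: k] => x; rewrite inE => /negPf ->. Qed.
Definition free_unit k := FreeModule (free_unitP k).

Lemma free_val_sum (I : finType) (F : I -> free_module) x :
  (\sum_i F i) x = \sum_i F i x.
Proof.
elim: (index_enum I) => [|i r IH]; first by rewrite !big_nil.
by rewrite !big_cons -IH.
Qed.

Lemma free_sum_supp (f : free_module) (s : seq K) :
  (forall x, x \notin s -> f x = 0) ->
  f = \sum_(i : seq_sub s) f (val i) *: free_unit (val i).
Proof.
move=> fs; apply: free_module_ext => x; rewrite free_val_sum.
have E (i : seq_sub s) :
    (f (val i) *: free_unit (val i)) x = f (val i) * (x == val i)%:R by [].
under eq_bigr do rewrite E.
have [xs|xs] := boolP (x \in s); last first.
  rewrite fs // big1 // => i _; case: eqP => [xi|_]; last by rewrite mulr0.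
  by rewrite xi (valP i) in xs.
rewrite (bigD1 (Sub x xs : seq_sub _)) //= eqxx mulr1 big1 ?addr0 // => i ne.
case: eqP => [xi|_]; last by rewrite mulr0.
by case/eqP: ne; apply: val_inj.
Qed.

Lemma free_lift (M : lmodType R) (c : K -> M) :
  exists g : {linear free_module -> M}, forall k, g (free_unit k) = c k.
Proof.
pose supp (f : free_module) := undup (projT1 (cid (free_valP f))).
have suppP f x : x \notin supp f -> f x = 0.
  by rewrite mem_undup; apply: (projT2 (cid (free_valP f))).
pose g f := \sum_(x <- supp f) f x *: c x.
have gE (f : free_module) s : uniq s -> {subset supp f <= s} ->
    g f = \sum_(x <- s) f x *: c x.
  move=> us sub; rewrite /g [RHS](bigID (mem (supp f))) /=.
  rewrite [X in _ + X]big1 ?addr0; last by move=> x /suppP ->; rewrite scale0r.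
  rewrite -[RHS]big_filter; apply: perm_big; apply: uniq_perm.
  - exact: undup_uniq.
  - exact: filter_uniq.
  - move=> x; rewrite mem_filter; case: (boolP (x \in supp f)) => //= xs.
    by rewrite sub.
have g_lin : linear g.
  move=> a f h; set s := undup (supp (a *: f + h) ++ supp f ++ supp h).
  have us : uniq s := undup_uniq _.
  have sub t : t \in [:: supp (a *: f + h); supp f; supp h] -> {subset t <= s}.
    move=> + x xt; rewrite mem_undup !mem_cat !inE => /or3P[] /eqP E.
    - by rewrite -E xt.
    - by rewrite -E xt orbT.
    - by rewrite -E xt !orbT.
  have Es t : supp t \in [:: supp (a *: f + h); supp f; supp h] ->
    g t = \sum_(x <- s) t x *: c x by move=> /sub; apply: gE.
  rewrite (Es (a *: f + h)) ?(Es f) ?(Es h) ?inE ?eqxx ?orbT //.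
  rewrite scaler_sumr -big_split /=.
  by apply: eq_bigr => x _; rewrite scalerA -scalerDl.
exists (mk_linear g_lin) => k /=.
have us : uniq (undup (k :: supp (free_unit k))) := undup_uniq _.
rewrite (gE _ _ us); last by move=> x xs; rewrite mem_undup inE xs orbT.
rewrite (bigD1_seq k) ?mem_undup ?mem_head //= eqxx scale1r.
by rewrite big1 ?addr0 // => x /negPf ->; rewrite scale0r.
Qed.

Lemma free_linear_ext (M : lmodType R) (g h : {linear free_module -> M}) :
  (forall k, g (free_unit k) = h (free_unit k)) -> forall x, g x = h x.
Proof.
move=> gh x; have [s /free_sum_supp ->] := free_valP x; rewrite !linear_sum.
by apply: eq_bigr => i _; rewrite !linearZ /= gh.
Qed.

Lemma free_projective : projective_module free_module.
Proof.
move=> A B q f q_surj; pose s y := projT1 (cid (q_surj y)).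
have qs y : q (s y) = y := projT2 (cid (q_surj y)).
have [g gE] := free_lift (fun k => s (f (free_unit k))).
exists g; apply: (@free_linear_ext _ (q \o g) f) => k.
by rewrite /= gE qs.
Qed.

End FreeModule.

Lemma free_cover (R : pzRingType) (M : lmodType R) :
  exists q : {linear free_module R M -> M}, forall y, exists x, q x = y.
Proof.
by have [q qE] := free_lift (id : M -> M); exists q => y; exists (free_unit R y).
Qed.

(** * Families and coefficient arrays *)

Section Arrays.
Variable R : pzRingType.
Implicit Types (I J S T : finType) (A : lmodType R^c) (M N : lmodType R).

(** With arrays read as matrices, [lact] is matrix times column, [ract] is row times matrix over a
    right module, and [cmul] is the matrix product. *)
Definition lact I S M (c : I -> S -> R) (b : S -> M) (i : I) : M :=
  \sum_s c i s *: b s.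

Definition ract I S A (c : I -> S -> R) (a : I -> A) (s : S) : A :=
  \sum_i (c i s : R^c) *: a i.

Definition cmul I S T (c : I -> S -> R) (d : S -> T -> R) (i : I) (t : T) : R :=
  \sum_s c i s * d s t.

Lemma lact_cmul I S T M (c : I -> S -> R) (d : S -> T -> R) (b : T -> M) i :
  lact (cmul c d) b i = lact c (lact d b) i.
Proof.
rewrite /lact /cmul.
under eq_bigr do rewrite scaler_suml; rewrite exchange_big /=.
apply: eq_bigr => s _; rewrite scaler_sumr; apply: eq_bigr => t _.
by rewrite scalerA.
Qed.

Lemma ract_cmul I S T A (c : I -> S -> R) (d : S -> T -> R) (a : I -> A) t :
  ract (cmul c d) a t = ract d (ract c a) t.
Proof.
rewrite /ract /cmul.
under eq_bigr do rewrite scaler_suml; rewrite exchange_big /=.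
apply: eq_bigr => s _; rewrite scaler_sumr; apply: eq_bigr => i _.
by rewrite scalerA.
Qed.

Lemma linear_lact I S M N (f : {linear M -> N}) (c : I -> S -> R) (b : S -> M) i :
  f (lact c b i) = lact c (f \o b) i.
Proof. by rewrite linear_sum; apply: eq_bigr => s _; rewrite linearZ. Qed.

Lemma linear_ract I S (A B : lmodType R^c) (f : {linear A -> B}) (c : I -> S -> R)
    (a : I -> A) s :
  f (ract c a s) = ract c (f \o a) s.
Proof. by rewrite linear_sum; apply: eq_bigr => i _; rewrite linearZ. Qed.

Lemma eq_lact I S M (c : I -> S -> R) (b b' : S -> M) i :
  (forall s, b s = b' s) -> lact c b i = lact c b' i.
Proof. by move=> E; apply: eq_bigr => s _; rewrite E. Qed.

Lemma eq_ract I S A (c : I -> S -> R) (a a' : I -> A) s :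
  (forall i, a i = a' i) -> ract c a s = ract c a' s.
Proof. by move=> E; apply: eq_bigr => i _; rewrite E. Qed.

Lemma lact0l I S M (c : I -> S -> R) (b : S -> M) i :
  (forall s, c i s = 0) -> lact c b i = 0.
Proof. by move=> E; apply: big1 => s _; rewrite E scale0r. Qed.

Lemma lactB I S M (c : I -> S -> R) (b b' : S -> M) i :
  lact c (fun s => b s - b' s) i = lact c b i - lact c b' i.
Proof. by rewrite /lact -sumrB; apply: eq_bigr => s _; rewrite scalerBr. Qed.

Lemma ractB I S A (c : I -> S -> R) (a a' : I -> A) s :
  ract c (fun i => a i - a' i) s = ract c a s - ract c a' s.
Proof. by rewrite /ract -sumrB; apply: eq_bigr => i _; rewrite scalerBr. Qed.

Definition pad X I J (f : I -> X) (g : J -> X) (x : I + J) : X :=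
  match x with inl i => f i | inr j => g j end.

Lemma sum_pad (V : nmodType) I J (F : I + J -> V) :
  \sum_x F x = \sum_i F (inl i) + \sum_j F (inr j).
Proof. exact: big_sumType. Qed.

End Arrays.

(** * Tensor products *)

Section Tensor.
Variable R : pzRingType.
Implicit Types (A B : lmodType R^c) (M N : lmodType R).

Definition tensor_pi A M (x : {freeg (A * M)}) : tensor A M := \pi_(tensor A M) x.

Lemma tensor_piB A M : zmod_morphism (@tensor_pi A M).
Proof.
pose I := GRing.ZmodClosed.clone {freeg (A * M)} (@tensor_pred R A M) _.
exact: (raddfB (\pi_(Quotient.quot I))).
Qed.
HB.instance Definition _ A M :=
  GRing.isZmodMorphism.Build {freeg (A * M)} (tensor A M) (@tensor_pi A M)
    (@tensor_piB A M).

Lemma tensor_pi_eq0 A M (x : {freeg (A * M)}) : tensor_pi x = 0 <-> tensor_rel x.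
Proof. by rewrite -(raddf0 (@tensor_pi A M)) -[x in tensor_rel x]subr0 -pi_tensorP. Qed.

Lemma tensE A M (a : A) (m : M) : tens a m = tensor_pi << (a, m) >>.
Proof. by []. Qed.

Lemma tensDl A M (a a' : A) (m : M) : tens (a + a') m = tens a m + tens a' m.
Proof.
apply/subr0_eq; rewrite opprD addrA !tensE -!raddfB /=.
exact/tensor_pi_eq0/tensor_relDl.
Qed.

Lemma tensDr A M (a : A) (m m' : M) : tens a (m + m') = tens a m + tens a m'.
Proof.
apply/subr0_eq; rewrite opprD addrA !tensE -!raddfB /=.
exact/tensor_pi_eq0/tensor_relDr.
Qed.

Lemma tensZ A M (r : R) (a : A) (m : M) : tens ((r : R^c) *: a) m = tens a (r *: m).
Proof.
by apply/subr0_eq; rewrite !tensE -raddfB; apply/tensor_pi_eq0/tensor_relZ.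
Qed.

Lemma tens0l A M (m : M) : tens (0 : A) m = 0.
Proof. by apply: (addrI (tens 0 m)); rewrite -tensDl !addr0. Qed.

Lemma tens0r A M (a : A) : tens a (0 : M) = 0.
Proof. by apply: (addrI (tens a 0)); rewrite -tensDr !addr0. Qed.

Lemma tensNl A M (a : A) (m : M) : tens (- a) m = - tens a m.
Proof. by apply: (addrI (tens a m)); rewrite -tensDl !subrr tens0l. Qed.

Lemma tensBr A M (a : A) (m m' : M) : tens a (m - m') = tens a m - tens a m'.
Proof. by apply/eqP; rewrite eq_sym subr_eq -tensDr subrK. Qed.

Lemma tens_suml I A M (a : I -> A) (m : M) (r : seq I) :
  tens (\sum_(i <- r) a i) m = \sum_(i <- r) tens (a i) m.
Proof. by elim: r => [|i r IH]; rewrite ?big_nil ?big_cons ?tens0l // tensDl IH. Qed.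

Lemma tens_sumr I A M (a : A) (m : I -> M) (r : seq I) :
  tens a (\sum_(i <- r) m i) = \sum_(i <- r) tens a (m i).
Proof. by elim: r => [|i r IH]; rewrite ?big_nil ?big_cons ?tens0r // tensDr IH. Qed.

Lemma tens_lact (I S : finType) A M (c : I -> S -> R) (a : I -> A) (b : S -> M) :
  \sum_i tens (a i) (lact c b i) = \sum_s tens (ract c a s) (b s).
Proof.
under eq_bigr do rewrite tens_sumr; rewrite exchange_big /=.
apply: eq_bigr => s _; rewrite tens_suml; apply: eq_bigr => i _.
by rewrite tensZ.
Qed.

Lemma tensor_sumE A M (x : tensor A M) :
  exists (I : finType) (a : I -> A) (m : I -> M), x = \sum_i tens (a i) (m i).
Proof.
have [y ->] : exists y, x = tensor_pi y by exists (repr x); rewrite /tensor_pi reprK.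
rewrite -(freeg_sumE y) raddf_sum /= big_tnth.
have E (z : A * M) (k : int) : tensor_pi << k *g z >> = tens (z.1 *~ k) z.2.
  have -> : << k *g z >> = << z >> *~ k by rewrite freegU_mulz intz.
  rewrite raddfMz; case: k => n.
    elim: n => [|n IH]; first by rewrite !mulr0z tens0l.
    rewrite -addn1 PoszD !mulrzDr tensDl IH !mulr1z; congr (_ + _).
    by rewrite tensE -surjective_pairing.
  rewrite NegzE !mulrNz tensNl; congr (- _); elim: n.+1 => [|{}n IH].
    by rewrite !mulr0z tens0l.
  rewrite -addn1 PoszD !mulrzDr tensDl IH !mulr1z; congr (_ + _).
  by rewrite tensE -surjective_pairing.
exists 'I_(size (dom y)),
  (fun i => let z := tnth (in_tuple (dom y)) i in z.1 *~ coeff z y),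
  (fun i => (tnth (in_tuple (dom y)) i).2).
by apply: eq_bigr => i _; rewrite E.
Qed.

Lemma tensor_mapB A B M N (f : {linear A -> B}) (g : {linear M -> N}) :
  zmod_morphism (tensor_map f g).
Proof.
move=> x y; rewrite -(reprK x) -(reprK y).
rewrite -[\pi_(tensor A M) (repr x)]/(tensor_pi _).
rewrite -[\pi_(tensor A M) (repr y)]/(tensor_pi _) -raddfB.
rewrite ![tensor_map f g _]tensor_map_pi raddfB.
exact: (raddfB (@tensor_pi B N)).
Qed.

HB.instance Definition _ A B M N (f : {linear A -> B}) (g : {linear M -> N}) :=
  GRing.isZmodMorphism.Build (tensor A M) (tensor B N) (tensor_map f g)
    (tensor_mapB f g).

Lemma tensor_map_sum A B M N (f : {linear A -> B}) (g : {linear M -> N})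
    (I : finType) (a : I -> A) (m : I -> M) :
  tensor_map f g (\sum_i tens (a i) (m i)) = \sum_i tens (f (a i)) (g (m i)).
Proof. by rewrite raddf_sum; apply: eq_bigr => i _; apply: tensor_map_tens. Qed.

Lemma tensor_map_surj A M N (g : {linear M -> N}) :
  (forall y, exists x, g x = y) ->
  forall y : tensor A N, exists x, tensor_map (idfun : {linear A -> A}) g x = y.
Proof.
move=> g_surj y; have [I [a [n ->]]] := tensor_sumE y.
exists (\sum_i tens (a i) (projT1 (cid (g_surj (n i))))).
rewrite tensor_map_sum; apply: eq_bigr => i _; congr (tens _ _).
exact: (projT2 (cid (g_surj (n i)))).
Qed.

(* Equational criterion for vanishing: [m = rho m'], [pi m' = 0] and
   [a rho = alpha pi] exhibit the sum as [alpha (x) pi m']. *)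
Lemma tens_sum0P A M (I : finType) (a : I -> A) (m : I -> M) :
  \sum_i tens (a i) (m i) = 0 ->
  exists (K S : finType) (alpha : K -> A) (m' : S -> M)
         (rho : I -> S -> R) (pi : K -> S -> R),
    [/\ forall i, m i = lact rho m' i, forall k, lact pi m' k = 0 &
        forall s, ract rho a s = ract pi alpha s].
Proof.
pose x := \sum_i (<< (a i, m i) >> : {freeg (A * M)}).
have -> : \sum_i tens (a i) (m i) = tensor_pi x by rewrite raddf_sum.
move=> /tensor_pi_eq0 x_rel.
(* The total coefficient in [A] of the element [n]: these are the coordinates of A (x) R^(M), where
   R^(M) is the free module on the set M. *)
pose Phi n : {freeg (A * M)} -> zmodule A :=
  fglift (fun p : A * M => (if p.2 == n then p.1 else 0) : zmodule A).
have PhiE n p : Phi n << p >> = if p.2 == n then p.1 else 0.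
  by rewrite /Phi liftU scale1r.
have PhiB n (y z : {freeg (A * M)}) : Phi n (y - z) = Phi n y - Phi n z :> A.
  exact: (raddfB (Phi n)).
have PhiS n : Phi n x = \sum_i Phi n << (a i, m i) >> :> A.
  exact: (raddf_sum (Phi n)).
have [ev evE] := free_lift (id : M -> M).
(* Each defining relation of the tensor product has, as an element of A (x) R^(M), the form of a sum
   of [alpha k (x) N k] with [N k] in the kernel of R^(M) -> M. *)
have [K [alpha [N [evN PhiN]]]] : exists (K : finType) (alpha : K -> A)
    (N : K -> free_module R M), (forall k, ev (N k) = 0) /\
    (forall n, Phi n x = \sum_k (N k n : R^c) *: alpha k :> A).
  elim: {x PhiS} x_rel => [|y z _ [K [al [N [evN PhiN]]]] _ [L [be [P [evP PhiP]]]]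
                     |b b' n|b n n'|r b n].
  - exists 'I_0, (fun=> 0), (fun=> 0); split=> [[]//|n]; rewrite big_ord0.
    exact: (raddf0 (Phi n)).
  - exists (K + L)%type, (pad al (fun l => - be l)), (pad N P).
    split=> [[k|l]|n]; [exact: evN|exact: evP|].
    rewrite PhiB PhiN PhiP sum_pad /= -sumrN; congr (_ + _).
    by apply: eq_bigr => l _; rewrite scalerN.
  - exists 'I_0, (fun=> 0), (fun=> 0); split=> [[]//|p]; rewrite big_ord0.
    rewrite !PhiB !PhiE /=.
    by case: eqP => _; rewrite ?subrr // addrAC addrK subrr.
  - exists 'I_1, (fun=> b),
      (fun=> free_unit R (n + n') - free_unit R n - free_unit R n').
    split=> [_|p]; first by rewrite !raddfB /= !evE addrAC addrK subrr.
    rewrite !PhiB !PhiE /= big_ord1.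
    rewrite -[X in _ = X *: _]/((p == n + n')%:R - (p == n)%:R - (p == n')%:R : R^c).
    rewrite !scalerBl ![_ == p]eq_sym; congr (_ - _ - _);
      by case: eqP => _; rewrite ?scale1r ?scale0r.
  - exists 'I_1, (fun=> b), (fun=> r *: free_unit R n - free_unit R (r *: n)).
    split=> [_|p]; first by rewrite linearB linearZ /= !evE subrr.
    rewrite PhiB !PhiE /= big_ord1.
    rewrite -[X in _ = X *: _]/((r * (p == n)%:R : R) - (p == r *: n)%:R : R^c).
    rewrite scalerBl ![_ == p]eq_sym; congr (_ - _).
      by case: eqP => _; rewrite ?mulr1 ?mulr0 ?scale0r.
    by case: eqP => _; rewrite ?scale1r ?scale0r.
pose supp k := projT1 (cid (free_valP (N k))).
have suppP k n : n \notin supp k -> N k n = 0 := projT2 (cid (free_valP (N k))) n.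
(* The new generators [m'] are the finitely many elements of [M] that occur, among the [m i] or in
   the supports of the [N k]. *)
pose s := flatten [seq supp k | k <- enum K] ++ [seq m i | i <- enum I].
have Ns k n : n \notin s -> N k n = 0.
  move=> ns; apply: suppP; apply: contra ns => ns; rewrite mem_cat; apply/orP; left.
  by apply/flatten_mapP; exists k; rewrite ?mem_enum.
have ms i : m i \in s by rewrite mem_cat map_f ?mem_enum ?orbT.
exists K, (seq_sub s), alpha, val,
  (fun i j => (m i == val j)%:R), (fun k j => N k (val j)).
split=> [i|k|j].
- rewrite /lact (bigD1 (Sub (m i) (ms i) : seq_sub s)) //= eqxx scale1r big1 ?addr0 //.
  move=> j ne; case: eqP => [mj|_]; last by rewrite scale0r.
  by case/eqP: ne; apply: val_inj.
- rewrite -[RHS](evN k) [N k in RHS](free_sum_supp (Ns k)) linear_sum.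
  by apply: eq_bigr => j _; rewrite linearZ /= evE.
- rewrite /ract -(PhiN (val j)) PhiS; apply: eq_bigr => i _.
  by rewrite PhiE /=; case: eqP => _; rewrite ?scale1r ?scale0r.
Qed.

(** A balanced biadditive [h] respects the vanishing certificate: [rho] moves to the left argument,
    turns into [pi] acting on [alpha], moves back and kills [m']. *)
Lemma tensor_eq_bal A M (G : zmodType) (h : A -> M -> G) (I J : finType)
    (a : I -> A) (m : I -> M) (b : J -> A) (n : J -> M) :
  (forall m, zmod_morphism (h^~ m)) -> (forall a, zmod_morphism (h a)) ->
  (forall (r : R) a m, h ((r : R^c) *: a) m = h a (r *: m)) ->
  \sum_i tens (a i) (m i) = \sum_j tens (b j) (n j) ->
  \sum_i h (a i) (m i) = \sum_j h (b j) (n j).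
Proof.
move=> hl hr hZ.
have h_lact (S T : finType) (c : S -> T -> R) (x : S -> A) (y : T -> M) :
    \sum_s h (x s) (lact c y s) = \sum_t h (ract c x t) (y t).
  have E1 s : h (x s) (lact c y s) = \sum_t h (x s) (c s t *: y t).
    exact: (raddf_sum (mk_additive (hr (x s)))).
  have E2 t : h (ract c x t) (y t) = \sum_s h (x s) (c s t *: y t).
    transitivity (\sum_s h ((c s t : R^c) *: x s) (y t)).
      exact: (raddf_sum (mk_additive (hl (y t)))).
    by apply: eq_bigr => s _; apply: hZ.
  under eq_bigr do rewrite E1; rewrite exchange_big.
  by apply: eq_bigr => t _; rewrite E2.
move=> E; apply/subr0_eq.
have : \sum_x tens (pad a (fun j => - b j) x) (pad m n x) = 0.
  rewrite sum_pad /= E; under [X in _ + X]eq_bigr do rewrite tensNl.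
  by rewrite sumrN subrr.
move=> /tens_sum0P [K [S [al [m' [rho [pi [mE piE aE]]]]]]].
have hN x y : h (- x) y = - h x y by exact: (raddfN (mk_additive (hl y))).
have <- : \sum_x h (pad a (fun j => - b j) x) (pad m n x) =
          \sum_i h (a i) (m i) - \sum_j h (b j) (n j).
  by rewrite sum_pad /=; under [X in _ + X]eq_bigr do rewrite hN; rewrite sumrN.
under eq_bigr do rewrite mE.
rewrite h_lact; under eq_bigr do rewrite aE; rewrite -h_lact.
by apply: big1 => k _; rewrite piE; apply: (raddf0 (mk_additive (hr (al k)))).
Qed.

Lemma tensor_lift A M (G : zmodType) (h : A -> M -> G) :
  (forall m, zmod_morphism (h^~ m)) -> (forall a, zmod_morphism (h a)) ->
  (forall (r : R) a m, h ((r : R^c) *: a) m = h a (r *: m)) ->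
  exists H : {additive tensor A M -> G}, forall a m, H (tens a m) = h a m.
Proof.
move=> hl hr hZ.
pose rep (x : tensor A M) (g : G) := exists (I : finType) (a : I -> A) (m : I -> M),
  x = \sum_i tens (a i) (m i) /\ g = \sum_i h (a i) (m i).
have rep_ex x : exists g, rep x g.
  have [I [a [m ->]]] := tensor_sumE x.
  by exists (\sum_i h (a i) (m i)), I, a, m.
have rep_uniq x g g' : rep x g -> rep x g' -> g = g'.
  move=> [I [a [m [-> ->]]]] [J [b [n [E ->]]]].
  exact: tensor_eq_bal E.
pose H x := projT1 (cid (rep_ex x)).
have HP x : rep x (H x) := projT2 (cid (rep_ex x)).
have HB : zmod_morphism H.
  move=> x y; apply: (rep_uniq (x - y)) => //.
  have [I [a [m [Ex ->]]]] := HP x; have [J [b [n [Ey ->]]]] := HP y.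
  exists (I + J)%type, (pad a (fun j => - b j)), (pad m n); rewrite Ex Ey !sum_pad /=.
  under [X in _ = _ + X /\ _]eq_bigr do rewrite tensNl.
  have hN u v : h (- u) v = - h u v by exact: (raddfN (mk_additive (hl v))).
  under [X in _ /\ _ = _ + X]eq_bigr do rewrite hN.
  by rewrite !sumrN.
exists (mk_additive HB) => a m; apply: (rep_uniq (tens a m)) => //.
by exists 'I_1, (fun=> a), (fun=> m); rewrite !big_ord1.
Qed.

End Tensor.

(** * Character modules *)

Section CharacterModule.
Variables (R : pzRingType) (X : Type) (Y : lmodType R).

(* The product, indexed by [X], of copies of the character module of [Y]. *)
Record chars := Chars {
  chars_val :> X -> Y -> QmodZ;
  charsB : forall x, zmod_morphism (chars_val x)
}.

Lemma chars_ext (f g : chars) : (forall x y, f x y = g x y) -> f = g.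
Proof.
case: f g => [f hf] [g hg] /= fg.
have E : f = g by apply/funext => x; apply/funext => y.
by move: hf hg; rewrite E => hf hg; congr Chars; apply: Prop_irrelevance.
Qed.

HB.instance Definition _ := gen_eqMixin chars.
HB.instance Definition _ := gen_choiceMixin chars.

Fact chars_zeroB (x : X) : zmod_morphism (fun _ : Y => 0 : QmodZ).
Proof. by move=> y z; rewrite subrr. Qed.
Fact chars_oppB (f : chars) (x : X) : zmod_morphism (fun y => - f x y).
Proof. by move=> y z; rewrite charsB opprB opprK addrC. Qed.
Fact chars_addB (f g : chars) (x : X) : zmod_morphism (fun y => f x y + g x y).
Proof. by move=> y z; rewrite !charsB opprD addrACA. Qed.
Fact chars_scaleB (r : R) (f : chars) (x : X) : zmod_morphism (fun y => f x (r *: y)).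
Proof. by move=> y z; rewrite scalerBr charsB. Qed.

Let zero := Chars chars_zeroB.
Let opp f := Chars (chars_oppB f).
Let add f g := Chars (chars_addB f g).
Let scale (r : R^c) f := Chars (chars_scaleB r f).

Fact chars_addA : associative add.
Proof. by move=> f g h; apply: chars_ext => x y; apply: addrA. Qed.
Fact chars_addC : commutative add.
Proof. by move=> f g; apply: chars_ext => x y; apply: addrC. Qed.
Fact chars_add0 : left_id zero add.
Proof. by move=> f; apply: chars_ext => x y; apply: add0r. Qed.
Fact chars_addN : left_inverse zero opp add.
Proof. by move=> f; apply: chars_ext => x y; apply: addNr. Qed.

HB.instance Definition _ :=
  GRing.isZmodule.Build chars chars_addA chars_addC chars_add0 chars_addN.

Fact chars_scaleA r s f : scale r (scale s f) = scale (r * s) f.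
Proof. by apply: chars_ext => x y /=; rewrite scalerA. Qed.
Fact chars_scale1 : left_id 1 scale.
Proof. by move=> f; apply: chars_ext => x y /=; rewrite scale1r. Qed.
Fact chars_scaleDr : right_distributive scale +%R.
Proof. by move=> r f g; apply: chars_ext. Qed.
Fact chars_scaleDl f : {morph scale^~ f : r s / r + s}.
Proof.
move=> r s; apply: chars_ext => x y /=; rewrite scalerDl.
exact: (raddfD (mk_additive (@charsB f x))).
Qed.

HB.instance Definition _ := GRing.Zmodule_isLmodule.Build R^c chars
  chars_scaleA chars_scale1 chars_scaleDr chars_scaleDl.

Lemma charsZE (r : R) (f : chars) x y : ((r : R^c) *: f) x y = f x (r *: y).
Proof. by []. Qed.

Lemma chars_raddf0 (f : chars) x : f x 0 = 0.
Proof. exact: (raddf0 (mk_additive (@charsB f x))). Qed.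

Lemma chars_sum_val (I : finType) (F : I -> chars) x y :
  (\sum_i F i) x y = \sum_i F i x y.
Proof.
elim: (index_enum I) => [|i r IH]; first by rewrite !big_nil.
by rewrite !big_cons -IH.
Qed.

Lemma chars_raddf_sum (f : chars) x (I : finType) (F : I -> Y) :
  f x (\sum_i F i) = \sum_i f x (F i).
Proof. exact: (raddf_sum (mk_additive (@charsB f x))). Qed.

Lemma chars_ract_lact (I S : finType) (c : I -> S -> R) (a : I -> chars)
    (y : S -> Y) x :
  \sum_i a i x (lact c y i) = \sum_s ract c a s x (y s).
Proof.
under eq_bigr do rewrite chars_raddf_sum; rewrite exchange_big /=.
by apply: eq_bigr => s _; rewrite /ract chars_sum_val.
Qed.

End CharacterModule.

(** * Flatness by linear equations *)

(** The equational criterion for flatness: finitely many relations among elements of [F] come from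
    relations that already hold between coefficients. *)
Definition eflat (R : pzRingType) (F : lmodType R) : Prop :=
  forall (I K : finType) (f : I -> F) (c : K -> I -> R),
  (forall k, lact c f k = 0) ->
  exists (S : finType) (rho : I -> S -> R) (f' : S -> F),
    (forall i, f i = lact rho f' i) /\ (forall k s, cmul c rho k s = 0).

Section Eflat.
Variable R : pzRingType.

(** Flatness trivialises the relations [pi] of the certificate by some [sig] with [pi sig = 0]; then
    [a rho sig] is killed by the injective [j]. *)
Lemma eflat_tensor_inj (Y : lmodType R) (A B : lmodType R^c) (j : {linear A -> B}) :
  eflat Y -> injective j ->
  forall x, tensor_map j (idfun : {linear Y -> Y}) x = 0 -> x = 0.
Proof.
move=> Yflat j_inj x; have [I [a [m ->]]] := tensor_sumE x.
rewrite tensor_map_sum /= => /tens_sum0P [K [S [al [m' [rho [pi [mE piE aE]]]]]]].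
have [T [sig [n [nE pisig]]]] := Yflat _ _ _ _ piE.
have mE' i : m i = lact (cmul rho sig) n i.
  by rewrite lact_cmul mE; apply: eq_lact => s; apply: nE.
under eq_bigr do rewrite mE'.
rewrite tens_lact big1 // => t _.
suff -> : ract (cmul rho sig) a t = 0 by apply: tens0l.
apply: j_inj; rewrite raddf0 linear_ract ract_cmul.
rewrite (@eq_ract _ _ _ _ _ _ (ract pi al)); last exact: aE.
by rewrite -ract_cmul /ract big1 // => k _; rewrite pisig scale0r.
Qed.

(** Maps from B to the character module of Y are characters of B (x) Y. Tensoring with the flat [Y]
    keeps [j] injective, so characters extend, one coordinate at a time. *)
Lemma chars_injective X (Y : lmodType R) : eflat Y -> injective_module (chars X Y).
Proof.
move=> Yflat A B j f j_inj.
have ext x : exists F : {additive tensor B Y -> QmodZ},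
    forall a y, F (tens (j a) y) = f a x y.
  have [|a|r a y|H HE] := @tensor_lift R A Y QmodZ (fun a y => f a x y).
  - by move=> y a b; rewrite raddfB.
  - exact: charsB.
  - by rewrite linearZ.
  pose J := tensor_map j (idfun : {linear Y -> Y}).
  have [|F FE] := @character_ext _ _ (J : {additive _ -> _}) H.
    by move=> z /(eflat_tensor_inj Yflat j_inj) ->; rewrite raddf0.
  by exists F => a y; rewrite -HE -FE /J /= tensor_map_tens.
pose F x := projT1 (cid (ext x)).
have FE x a y : F x (tens (j a) y) = f a x y := projT2 (cid (ext x)) a y.
have gB b x : zmod_morphism (fun y => F x (tens b y)).
  by move=> y z; rewrite tensBr raddfB.
pose g b := Chars (gB b).
have g_lin : linear g.
  move=> r b c; apply: chars_ext => x y /=.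
  by rewrite tensDl raddfD (@tensZ R).
exists (mk_linear g_lin) => a; apply: chars_ext => x y; exact: FE.
Qed.

(** In model-theoretic terms, the validity in [Y] of an implication between two positive primitive
    formulas. *)
Definition sequent (Y : lmodType R) (I K S T : finType) (rho : I -> S -> R)
    (pi : K -> S -> R) (la : I -> T -> R) : Prop :=
  forall y : S -> Y, (forall k, lact pi y k = 0) ->
  exists u : T -> Y, forall i, lact rho y i = lact la u i.

Section Uniform.
Variables (Y A B C : lmodType R) (f : {linear A -> B}) (g : {linear B -> C}).
Hypothesis Yflat : eflat Y.
Hypothesis fg_exact : forall J : lmodType R^c, injective_module J ->
  forall x, tensor_map (idfun : {linear J -> J}) g x = 0 ->
  exists y, tensor_map (idfun : {linear J -> J}) f y = x.

(* Exactness at the tautological element of [J (x) B], where [J] is the product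
   of copies of the character module of [Y] over all families of characters
   killing [la], yields equations valid for all these families at once. *)
Lemma uniform_exactness (I T : finType) (b : I -> B) (la : I -> T -> R) (c : T -> C) :
  (forall i, g (b i) = lact la c i) ->
  exists (K S : finType) (b' : S -> B) (x : K -> A)
         (rho : I -> S -> R) (pi : K -> S -> R),
    [/\ forall i, b i = lact rho b' i, forall k, f (x k) = lact pi b' k &
        sequent Y rho pi la].
Proof.
move=> gb.
pose X := {a : I -> chars unit Y | forall t, ract la a t = 0}.
have tautB i (x : X) : zmod_morphism (fun y => sval x i tt y) by exact: charsB.
pose a i : chars X Y := Chars (tautB i).
have a_la t : ract la a t = 0.
  apply: chars_ext => x y; rewrite /ract chars_sum_val.
  have := congr1 (fun h : chars unit Y => h tt y) (proj2_sig x t).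
  by rewrite /ract chars_sum_val.
have [|z Ez] := fg_exact (@chars_injective X Y Yflat) (x := \sum_i tens (a i) (b i)).
  rewrite tensor_map_sum /=; under eq_bigr do rewrite gb.
  by rewrite tens_lact big1 // => t _; rewrite a_la tens0l.
have [K [al [x zE]]] := tensor_sumE z.
have : \sum_p tens (pad a (fun k => - al k) p) (pad b (f \o x) p) = 0.
  rewrite sum_pad /= -Ez zE tensor_map_sum -big_split big1 // => k _.
  by rewrite /= tensNl subrr.
move=> /tens_sum0P [L [S [be [b' [rho [pi [bE piE aE]]]]]]].
exists (K + L)%type, S, b', (pad x (fun=> 0)), (fun i s => rho (inl i) s),
  (pad (fun k s => rho (inr k) s) pi); split.
- by move=> i; apply: (bE (inl i)).
- case=> [k|l]; first exact: (bE (inr k)).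
  by rewrite /= raddf0 -[LHS](piE l).
move=> y piy.
pose lam (v : {ffun T -> Y}) : {ffun I -> Y} := [ffun i => lact la v i].
have lamB : zmod_morphism lam.
  move=> v w; apply/ffunP => i; rewrite !ffunE -lactB.
  by apply: eq_lact => t; rewrite !ffunE.
pose w : {ffun I -> Y} := [ffun i => lact (fun i s => rho (inl i) s) y i].
(* If [rho y] is not in the image of [la], some character of Y^I vanishes on this image but not at
   [rho y]. Its components kill [la], so they form one of the coordinates of the product. *)
apply: contrapT => nu; have [|F [Flam Fw]] := @character_sep _ _ (mk_additive lamB) w.
  move=> [v vw]; apply: nu; exists v => i.
  by have := congr1 (fun h : {ffun I -> Y} => h i) vw; rewrite /= !ffunE.
have [chi0 [chi0B FE0]] := ffun_character F.
pose chi i := Chars (fun _ : unit => chi0B i).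
have FE (h : {ffun I -> Y}) : F h = \sum_i chi i tt (h i) := FE0 h.
have chi_la t : ract la chi t = 0.
  apply: chars_ext => -[] v.
  transitivity (F (lam [ffun t' => if t' == t then v else 0])); last exact: Flam.
  rewrite FE /ract chars_sum_val; apply: eq_bigr => i _; rewrite charsZE.
  congr (chi i tt _); rewrite ffunE /lact (bigD1 t) //= ffunE eqxx big1 ?addr0 //.
  by move=> t' ne; rewrite ffunE (negPf ne) scaler0.
pose x0 : X := exist _ chi chi_la.
apply: Fw; rewrite FE.
(* At the coordinate [x0] the certificate expresses the character through the equations that [y]
   satisfies, so its value at [rho y] is zero. *)
have aE' s : ract (fun i s => rho (inl i) s) chi s tt (y s) =
    \sum_k al k x0 (rho (inr k) s *: y s) + \sum_l be l x0 (pi l s *: y s).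
  have := congr1 (fun h : chars X Y => h x0 (y s)) (aE s).
  rewrite /ract !chars_sum_val sum_pad /= => E; rewrite -E.
  rewrite addrCA -big_split /= [X in _ = _ + X]big1 ?addr0 //.
  by move=> k _; rewrite addrN.
transitivity (\sum_s ract (fun i s => rho (inl i) s) chi s tt (y s)).
  by rewrite -chars_ract_lact; apply: eq_bigr => i _; rewrite /w ffunE.
under eq_bigr do rewrite aE'; rewrite big_split /= exchange_big /=.
rewrite [X in _ + X]exchange_big /= !big1 ?addr0 // => k _;
  rewrite -chars_raddf_sum.
  by have := piy (inr k); rewrite /lact /= => ->; rewrite chars_raddf0.
by have := piy (inl k); rewrite /lact /= => ->; rewrite chars_raddf0.
Qed.

End Uniform.

End Eflat.

(** * Permanence properties of flatness, purity, finite free modules *)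

Section EflatModules.
Variable R : pzRingType.
Implicit Types (E F L M N P Z : lmodType R).

Lemma eflat_regular : eflat (R^o : lmodType R).
Proof.
move=> I K f c cf; exists 'I_1, (fun i _ => f i), (fun _ => 1); split=> [i|k s].
  by rewrite /lact big_ord1 -[RHS]/(f i * 1) mulr1.
exact: cf.
Qed.

Lemma eflat_free (K : choiceType) : eflat (free_module R K).
Proof.
move=> I L f c cf.
pose supp i := projT1 (cid (free_valP (f i))).
have suppP i x : x \notin supp i -> f i x = 0 := projT2 (cid (free_valP (f i))) x.
pose s := flatten [seq supp i | i <- enum I].
have fs i x : x \notin s -> f i x = 0.
  move=> xs; apply: suppP; apply: contra xs => xs.
  by apply/flatten_mapP; exists i; rewrite ?mem_enum.
exists (seq_sub s), (fun i j => f i (val j)), (fun j => free_unit R (val j)).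
split=> [i|l j]; first exact: free_sum_supp (fs i).
have := congr1 (fun h : free_module R K => h (val j)) (cf l).
by rewrite /lact free_val_sum.
Qed.

Lemma eflat_retract E F (i : {linear F -> E}) (p : {linear E -> F}) :
  (forall x, p (i x) = x) -> eflat E -> eflat F.
Proof.
move=> pi Eflat I K f c cf.
have [|S [rho [f' [fE crho]]]] := Eflat I K (i \o f) c.
  by move=> k; rewrite -linear_lact cf raddf0.
exists S, rho, (p \o f'); split=> // j.
by rewrite -(pi (f j)) -linear_lact; congr (p _); apply: fE.
Qed.

Lemma projective_eflat P : projective_module P -> eflat P.
Proof.
move=> Pproj; have [q q_surj] := free_cover P.
have [i qi] := Pproj _ _ q (idfun : {linear P -> P}) q_surj.
exact: (eflat_retract qi (@eflat_free _)).
Qed.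

Definition linpair L M N (f : {linear L -> M}) (g : {linear L -> N}) :
  {linear L -> (M * N)%type}.
Proof.
apply: (@mk_linear R L (M * N)%type (fun x => (f x, g x))).
by move=> a x y; rewrite !linearP.
Defined.

Lemma linzero_linear M N : linear (fun _ : M => 0 : N).
Proof. by move=> a x y; rewrite scaler0 addr0. Qed.
Definition linzero M N : {linear M -> N} := mk_linear (@linzero_linear M N).

Definition linfst M N : {linear (M * N)%type -> M} := fst.
Definition linsnd M N : {linear (M * N)%type -> N} := snd.
Definition lininl M N : {linear M -> (M * N)%type} := linpair idfun (linzero M N).
Definition lininr M N : {linear N -> (M * N)%type} := linpair (linzero N M) idfun.

Lemma lact_pair (I S : finType) M N (c : I -> S -> R) (b : S -> (M * N)%type) i :
  lact c b i = (lact c (fst \o b) i, lact c (snd \o b) i).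
Proof.
rewrite [LHS]surjective_pairing.
by rewrite (linear_lact (linfst M N)) (linear_lact (linsnd M N)).
Qed.

Lemma eflat_prod E F : eflat E -> eflat F -> eflat (E * F)%type.
Proof.
move=> Eflat Fflat I K f c cf.
have [|S [rho [f1 [f1E crho]]]] := Eflat I K (fst \o f) c.
  by move=> k; have := congr1 fst (cf k); rewrite lact_pair.
have [|T [sig [f2 [f2E csig]]]] := Fflat I K (snd \o f) c.
  by move=> k; have := congr1 snd (cf k); rewrite lact_pair.
exists (S + T)%type, (fun i => pad (rho i) (sig i)),
  (pad (fun s => (f1 s, 0)) (fun t => (0, f2 t))); split=> [i|k [s|t]].
- rewrite [f i]surjective_pairing lact_pair /lact !sum_pad /=.
  rewrite [X in (_ + X, _)]big1 ?addr0; last by move=> t _; rewrite scaler0.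
  rewrite [X in (_, X + _)]big1 ?add0r; last by move=> t _; rewrite scaler0.
  by congr pair; [apply: f1E | apply: f2E].
- exact: crho.
- exact: csig.
Qed.

(** In E the relations are trivialised by [k z = rho x]. Then [rho (e x) = 0], and trivialising this
    in F allows a correction of [x] that puts it in the kernel without changing [rho x]. *)
Lemma ker_eflat Z E F (k : {linear Z -> E}) (e : {linear E -> F}) :
  eflat E -> eflat F -> injective k -> exact_at k e ->
  (forall y, exists x, e x = y) -> eflat Z.
Proof.
move=> Eflat Fflat k_inj ke e_surj I K z c cz.
have [|S [rho [x [zx crho]]]] := Eflat I K (k \o z) c.
  by move=> j; rewrite -linear_lact cz raddf0.
have [|T [sig [y [xy rhosig]]]] := Fflat S I (e \o x) rho.
  by move=> i; rewrite -linear_lact -zx; apply/ke; exists (z i).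
pose x' t := projT1 (cid (e_surj (y t))).
have ex' t : e (x' t) = y t := projT2 (cid (e_surj (y t))).
have kerx s : exists w, k w = x s - lact sig x' s.
  apply/ke; rewrite linearB (linear_lact e) -[e (x s)]/((e \o x) s) xy.
  by apply/eqP; rewrite subr_eq0; apply/eqP/eq_lact => t; rewrite /= ex'.
pose w s := projT1 (cid (kerx s)).
have kw s : k (w s) = x s - lact sig x' s := projT2 (cid (kerx s)).
exists S, rho, w; split=> // i; apply: k_inj.
rewrite linear_lact -[LHS]/((k \o z) i) zx -[LHS]subr0.
rewrite [RHS](@eq_lact _ _ _ _ _ _ (fun s => x s - lact sig x' s)) //.
rewrite lactB -lact_cmul [X in _ = _ - X]lact0l //.
Qed.

(** Uniform exactness over the ring itself writes [z = rho b] with [pi b = 0], and flatness of Z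
    gives [b = mu b'] with [pi mu = 0]. The columns of [mu] are solutions over R, so [rho mu] is
    [la] times a matrix [U], and [U b'] solves the system. *)
Lemma eflat_pure Z M (f : {linear Z -> M}) :
  eflat Z ->
  (forall J : lmodType R^c, injective_module J ->
     forall x, tensor_map (idfun : {linear J -> J}) f x = 0 -> x = 0) ->
  forall (I T : finType) (z : I -> Z) (la : I -> T -> R) (c : T -> M),
    (forall i, f (z i) = lact la c i) ->
    exists s : T -> Z, forall i, z i = lact la s i.
Proof.
move=> Zflat f_inj I T z la c fz.
have [|K [S [b [x [rho [pi [zE piE seq]]]]]]] :=
    @uniform_exactness R R^o Z Z M (linzero Z Z) f eflat_regular _ I T z la c fz.
  by move=> J Jinj x /(f_inj _ Jinj) ->; exists 0; rewrite raddf0.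
have [|S' [mu [b' [bE pimu]]]] := Zflat S K b pi; first by move=> k; rewrite -piE.
have sol s' : exists u : T -> R^o,
    forall i, lact rho (fun s => mu s s' : R^o) i = lact la u i.
  by apply: (seq (fun s => mu s s' : R^o)) => k; apply: pimu.
pose U t s' : R := projT1 (cid (sol s')) t.
have UE s' i : cmul rho mu i s' = cmul la U i s' := projT2 (cid (sol s')) i.
exists (lact U b') => i; rewrite zE -lact_cmul.
rewrite (@eq_lact _ _ _ _ _ _ (lact mu b') _ bE) -lact_cmul.
by apply: eq_bigr => s' _; rewrite UE.
Qed.

Definition rows (I : finType) : lmodType R := {ffun I -> R^o}.
Definition row_unit (I : finType) (i : I) : rows I :=
  [ffun i' => if i' == i then 1 else 0].

Definition cols (I : finType) : lmodType R^c := {ffun I -> (R^c)^o}.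
Definition col_unit (I : finType) (i : I) : cols I :=
  [ffun i' => if i' == i then 1 else 0].

Lemma comb_linear (I : finType) M (g : I -> M) :
  linear (fun v : rows I => \sum_i (v i : R) *: g i).
Proof.
move=> a v w; rewrite scaler_sumr -big_split; apply: eq_bigr => i _ /=.
by rewrite !ffunE scalerDl scalerA.
Qed.
Definition comb (I : finType) M (g : I -> M) : {linear rows I -> M} :=
  mk_linear (comb_linear g).

Lemma comb_unit (I : finType) M (g : I -> M) i : comb g (row_unit i) = g i.
Proof.
rewrite /= (bigD1 i) //= ffunE eqxx scale1r big1 ?addr0 // => j ne.
by rewrite ffunE (negPf ne) scale0r.
Qed.

Lemma rows_sumE (I : finType) (v : rows I) : v = \sum_i (v i : R) *: row_unit i.
Proof.
apply/ffunP => i; rewrite sum_ffunE (bigD1 i) //= !ffunE eqxx big1 ?addr0.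
  by rewrite -[RHS]/(v i * 1) mulr1.
by move=> j ne; rewrite !ffunE eq_sym (negPf ne) scaler0.
Qed.

Lemma rows_linE (I : finType) M (f : {linear rows I -> M}) v :
  f v = comb (fun i => f (row_unit i)) v.
Proof.
by rewrite {1}(rows_sumE v) linear_sum; apply: eq_bigr => i _; rewrite linearZ.
Qed.

Lemma colmap_linear (I K : finType) (c : K -> I -> R) :
  linear (fun v : cols I => [ffun k => \sum_i c k i * (v i : R)] : cols K).
Proof.
move=> r v w; apply/ffunP => k; rewrite !ffunE.
rewrite -[r *: \sum_i _]/((\sum_i c k i * (v i : R)) * (r : R)) mulr_suml -big_split /=.
by apply: eq_bigr => i _; rewrite !ffunE mulrDr mulrA.
Qed.
Definition colmap (I K : finType) (c : K -> I -> R) : {linear cols I -> cols K} :=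
  mk_linear (colmap_linear c).

Lemma colmap_unit (I K : finType) (c : K -> I -> R) i :
  colmap c (col_unit i) = \sum_k (c k i : R^c) *: col_unit k.
Proof.
apply/ffunP => k; rewrite sum_ffunE !ffunE (bigD1 i) //= ffunE eqxx mulr1.
rewrite big1 ?addr0; last by move=> j ne; rewrite ffunE (negPf ne) mulr0.
rewrite (bigD1 k) //= !ffunE eqxx big1 ?addr0; last first.
  by move=> j ne; rewrite !ffunE eq_sym (negPf ne) scaler0.
by rewrite -[RHS]/(1 * c k i) mul1r.
Qed.

(** The relations say that the sum of the [e_i (x) f i], with [e_i] the unit columns, lies in the
    kernel of [c (x) F]. By flatness it comes from ker c (x) F, and the elements of ker c that occur
    are the columns of [rho]. *)
Lemma flat_eflat F : flat_module F -> eflat F.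
Proof.
move=> Fflat I K f c cf.
have [N [nu [_ nug]]] := ker_exists (colmap c).
pose y := \sum_i tens (col_unit i) (f i).
have : tensor_map (colmap c) (idfun : {linear F -> F}) y = 0.
  rewrite tensor_map_sum; under eq_bigr do rewrite colmap_unit tens_suml.
  rewrite exchange_big /= big1 // => k _.
  under eq_bigr do rewrite tensZ.
  by rewrite -tens_sumr -/(lact c f k) cf tens0r.
move=> /(Fflat _ _ _ nu _ nug) [x].
have [S [n [f' ->]]] := tensor_sumE x; rewrite tensor_map_sum /= => E.
pose h i (v : cols I) (m : F) := (v i : R) *: m.
have coord i : \sum_s h i (nu (n s)) (f' s) = \sum_j h i (col_unit j) (f j).
  apply: tensor_eq_bal E => [m v w|v m m'|r v m]; rewrite /h.
  - by rewrite !ffunE scalerBl.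
  - by rewrite scalerBr.
  - by rewrite ffunE scalerA.
exists S, (fun i s => nu (n s) i), f'; split=> [i|k s].
  rewrite [RHS]coord (bigD1 i) //= /h ffunE eqxx scale1r big1 ?addr0 //.
  by move=> j ne; rewrite ffunE eq_sym (negPf ne) scale0r.
have : colmap c (nu (n s)) = 0 by apply/nug; exists (n s).
by move/(congr1 (fun v : cols K => v k)); rewrite ffunE [in RHS]ffunE.
Qed.

End EflatModules.

(** * Right exact functors *)

(** The laws take pointwise equalities of maps as premises, so that composites need not be
    identified as bundled linear maps. *)
Record rex_functor (R : pzRingType) := RexFunctor {
  rex_ob :> lmodType R -> zmodType;
  rex_map : forall M N : lmodType R,
    {linear M -> N} -> {additive rex_ob M -> rex_ob N};
  rex_comp : forall (L M N : lmodType R) (f : {linear L -> M}) (g : {linear M -> N})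
    (h : {linear L -> N}), (forall x, g (f x) = h x) ->
    forall x, rex_map g (rex_map f x) = rex_map h x;
  rex_add : forall (M N : lmodType R) (f g h : {linear M -> N}),
    (forall x, h x = f x + g x) -> forall x, rex_map h x = rex_map f x + rex_map g x;
  rex_id : forall (M : lmodType R) (f : {linear M -> M}),
    (forall x, f x = x) -> forall x, rex_map f x = x;
  rex_surj : forall (M N : lmodType R) (f : {linear M -> N}),
    (forall y, exists x, f x = y) -> forall y, exists x, rex_map f x = y;
  rex_exact : forall (L M N : lmodType R) (f : {linear L -> M}) (g : {linear M -> N}),
    exact_at f g -> (forall y, exists x, g x = y) ->
    exact_at (rex_map f) (rex_map g)
}.

Section Functors.
Variable R : pzRingType.
Implicit Types (E F K L M N P Z : lmodType R) (T : rex_functor R).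

Definition idrex : rex_functor R.
Proof.
apply: (@RexFunctor R (fun M => M) (fun M N f => f)).
- by [].
- by [].
- by [].
- by [].
- by [].
Defined.

Definition tensor_rex (J : lmodType R^c) : rex_functor R.
Proof.
apply: (@RexFunctor R (fun M => tensor J M)
  (fun M N f => tensor_map (idfun : {linear J -> J}) f)).
- move=> L M N f g h gf x; have [I [a [m ->]]] := tensor_sumE x.
  by rewrite /= !tensor_map_sum /=; apply: eq_bigr => i _; rewrite gf.
- move=> M N f g h hfg x; have [I [a [m ->]]] := tensor_sumE x.
  rewrite /= !tensor_map_sum -big_split /=; apply: eq_bigr => i _.
  by rewrite hfg tensDr.
- move=> M f fx x; have [I [a [m ->]]] := tensor_sumE x.
  by rewrite /= tensor_map_sum; apply: eq_bigr => i _; rewrite fx.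
- by move=> M N f f_surj; apply: tensor_map_surj.
move=> L M N f g fg g_surj z; split=> [|[x <-]]; last first.
  have [I [a [m ->]]] := tensor_sumE x; rewrite /= !tensor_map_sum big1 //= => i _.
  by have /fg -> : exists x, f x = f (m i) by [exists (m i)]; rewrite tens0r.
have [I [a [b ->]]] := tensor_sumE z; rewrite /= tensor_map_sum /=.
(* Once [c] is lifted along [g], both [b - rho b'] and [pi b'] come from L, and their preimages [x]
   and [w] assemble to a preimage of the given tensor. *)
move=> /tens_sum0P [K [S [al [c [rho [pi [gb pic aE]]]]]]].
pose b' s := projT1 (cid (g_surj (c s))).
have gb' s : g (b' s) = c s := projT2 (cid (g_surj (c s))).
have kerb i : exists x, f x = b i - lact rho b' i.
  apply/fg; rewrite linearB (linear_lact g) gb; apply/eqP; rewrite subr_eq0.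
  by apply/eqP/eq_lact => s /=; rewrite gb'.
have kerp k : exists x, f x = lact pi b' k.
  apply/fg; rewrite (linear_lact g) -(pic k); apply: eq_lact => s; exact: gb'.
pose x i := projT1 (cid (kerb i)); have fx i : f (x i) = _ := projT2 (cid (kerb i)).
pose w k := projT1 (cid (kerp k)); have fw k : f (w k) = _ := projT2 (cid (kerp k)).
exists (\sum_i tens (a i) (x i) + \sum_k tens (al k) (w k)).
rewrite raddfD /= !tensor_map_sum /=; under [X in _ + X]eq_bigr do rewrite fw.
rewrite tens_lact; under [X in _ + X]eq_bigr do rewrite -aE.
rewrite -tens_lact -big_split; apply: eq_bigr => i _ /=.
by rewrite -tensDr fx subrK.
Defined.

(* Testing with [idrex] is plain exactness, so that one diagram chase serves for
   both exactness and its preservation by tensor products. *)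
Inductive testing : rex_functor R -> Prop :=
| testing_id : testing idrex
| testing_tensor J : injective_module J -> testing (tensor_rex J).

Section Basic.
Variable T : rex_functor R.

Lemma rex_zero M N (f : {linear M -> N}) :
  (forall x, f x = 0) -> forall x, rex_map T f x = 0.
Proof.
move=> f0 x; have := @rex_add R T M N f f f _ x.
move=> /(_ (fun y => _)) E; apply: (addrI (rex_map T f x)).
by rewrite addr0 -E // => y; rewrite !f0 addr0.
Qed.

Lemma rex_comp0 L M N (f : {linear L -> M}) (g : {linear M -> N}) :
  (forall x, g (f x) = 0) -> forall x, rex_map T g (rex_map T f x) = 0.
Proof.
move=> gf x; rewrite (@rex_comp _ T _ _ _ f g (linzero L N)) //.
exact: rex_zero.
Qed.

Lemma rex_comp2 L M M' N (f : {linear L -> M}) (g : {linear M -> N})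
    (f' : {linear L -> M'}) (g' : {linear M' -> N}) :
  (forall x, g (f x) = g' (f' x)) ->
  forall x, rex_map T g (rex_map T f x) = rex_map T g' (rex_map T f' x).
Proof.
move=> E x; rewrite (@rex_comp _ T _ _ _ f g (g' \o f')) //.
by rewrite (@rex_comp _ T _ _ _ f' g' (g' \o f')).
Qed.

End Basic.

Lemma ker_lift L M N P (k : {linear L -> M}) (p : {linear M -> N}) (h : {linear P -> M}) :
  injective k -> exact_at k p -> (forall x, p (h x) = 0) ->
  exists t : {linear P -> L}, forall x, k (t x) = h x.
Proof.
move=> k_inj kp ph; have kt x : exists y, k y = h x by apply/kp.
pose t x := projT1 (cid (kt x)); have tE x : k (t x) = h x := projT2 (cid (kt x)).
have t_lin : linear t by move=> a x y; apply: k_inj; rewrite linearP !tE linearP.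
by exists (mk_linear t_lin).
Qed.

(** A flat quotient makes the kernel pure. The [x] of a certificate in E satisfy [rho] and [pi]
    modulo Z; trivialising both at once in F corrects [x] to elements of Z, which certify the
    vanishing there. *)
Lemma ker_pure Z E F (k : {linear Z -> E}) (e : {linear E -> F}) :
  eflat F -> injective k -> exact_at k e -> (forall y, exists x, e x = y) ->
  forall T, testing T -> forall z, rex_map T k z = 0 -> z = 0.
Proof.
move=> Fflat k_inj ke e_surj T [|J _] z.
  by rewrite -[RHS](raddf0 k); apply: k_inj.
have [I [a [y ->]]] := tensor_sumE z; rewrite /= tensor_map_sum /=.
move=> /tens_sum0P [K [S [al [x [rho [pi [yE pix aE]]]]]]].
have [|U [sig [n [nE rel]]]] := Fflat S (I + K)%type (e \o x) (pad rho pi).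
  case=> [i|k']; rewrite -linear_lact /=.
    by rewrite -[lact _ _ _]/(lact rho x i) -yE; apply/ke; exists (y i).
  by rewrite -[lact _ _ _]/(lact pi x k') pix raddf0.
pose n' t := projT1 (cid (e_surj (n t))).
have en' t : e (n' t) = n t := projT2 (cid (e_surj (n t))).
have kerx s : exists w, k w = x s - lact sig n' s.
  apply/ke; rewrite linearB (linear_lact e) -[e (x s)]/((e \o x) s) nE.
  by apply/eqP; rewrite subr_eq0; apply/eqP/eq_lact => t; rewrite /= en'.
pose w s := projT1 (cid (kerx s)).
have kw s : k (w s) = x s - lact sig n' s := projT2 (cid (kerx s)).
have lift (J' : finType) (c : J' -> S -> R) j :
    (forall t, cmul c sig j t = 0) -> k (lact c w j) = lact c x j.
  move=> csig; rewrite linear_lact (@eq_lact _ _ _ _ _ _ (fun s => x s - lact sig n' s)) //.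
  by rewrite lactB -lact_cmul [X in _ - X]lact0l ?subr0.
have yw i : y i = lact rho w i.
  by apply: k_inj; rewrite lift ?yE // => t; apply: (rel (inl i)).
have piw k' : lact pi w k' = 0.
  by apply: k_inj; rewrite lift ?pix ?raddf0 // => t; apply: (rel (inr k')).
under eq_bigr do rewrite yw; rewrite tens_lact.
under eq_bigr do rewrite aE; rewrite -tens_lact big1 // => k' _.
by rewrite piw tens0r.
Qed.

(** * Syzygies to the left *)

(** The last clause is the vanishing of Tor in positive degrees against injective right modules,
    together with plain exactness. At [F 0] right exactness takes care of the tests. *)
Definition flat_resolved K : Prop :=
  exists (F : nat -> lmodType R) (d : forall k, {linear F k.+1 -> F k})
         (e : {linear F 0%N -> K}),
    [/\ forall k, eflat (F k), forall y, exists x, e x = y, exact_at (d 0%N) e &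
        forall T, testing T -> forall k, exact_at (rex_map T (d k.+1)) (rex_map T (d k))].

(** With [s : P -> F 0] a comparison map, the pullback Y of [d 0] and [s] is flat and maps onto K',
    and ... -> F 3 -> F 2 -> Y is a flat resolution of K'. *)
Lemma flat_resolved_kernel K P K' (p : {linear P -> K}) (k : {linear K' -> P}) :
  flat_resolved K -> projective_module P -> (forall y, exists x, p x = y) ->
  injective k -> exact_at k p ->
  (forall T, testing T -> forall x, rex_map T k x = 0 -> x = 0) /\ flat_resolved K'.
Proof.
move=> [F [d [e [Fflat e_surj d0e dd]]]] Pproj p_surj k_inj kp.
have ddid i : exact_at (d i.+1) (d i) := dd _ testing_id i.
have [s es] := Pproj _ _ e p e_surj.
(* Its kernel is the pullback; being onto, it exhibits this kernel as a kernel between flat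
   modules. *)
pose phi : {linear (F 1%N * P)%type -> F 0%N} :=
  (d 0%N \o linfst _ _) \- (s \o linsnd _ _).
have phi_surj y : exists x, phi x = y.
  have [v pv] := p_surj (e y).
  have [x dx] : exists x, d 0%N x = y - s v.
    by apply/d0e; rewrite linearB es pv subrr.
  exists (x, - v); rewrite /phi /= [X in _ - X]raddfN /= dx opprK subrK //.
have [Y [kap [kap_inj kap_phi]]] := ker_exists phi.
have Yflat : eflat Y.
  apply: ker_eflat kap_inj kap_phi phi_surj => //.
  by apply: eflat_prod => //; apply: projective_eflat.
pose y1 : {linear Y -> F 1%N} := linfst _ _ \o kap.
pose y2 : {linear Y -> P} := linsnd _ _ \o kap.
have y12 y : d 0%N (y1 y) = s (y2 y).
  by apply/eqP; rewrite -subr_eq0; apply/eqP/kap_phi; exists y.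
have [t kt] : exists t : {linear Y -> K'}, forall y, k (t y) = y2 y.
  apply: ker_lift k_inj kp _ => y; rewrite -es -y12.
  by apply/d0e; exists (y1 y).
have [d' kapd'] : exists d' : {linear F 2%N -> Y},
    forall x, kap (d' x) = lininl _ _ (d 1%N x).
  apply: (@ker_lift _ _ _ _ kap phi (lininl _ _ \o d 1%N) kap_inj kap_phi) => x.
  rewrite /phi /= raddf0 subr0; apply/ddid; by exists x.
have td' x : t (d' x) = 0.
  by apply: k_inj; rewrite kt /y2 /= kapd' raddf0.
have y1d' x : y1 (d' x) = d 1%N x by rewrite /y1 /= kapd'.
have t_surj v : exists y, t y = v.
  have [x dx] : exists x, d 0%N x = s (k v).
    by apply/d0e; rewrite es; apply/kp; exists v.
  have [y ky] : exists y, kap y = (x, k v).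
    by apply/kap_phi; rewrite /phi /= dx subrr.
  by exists y; apply: k_inj; rewrite kt /y2 /= ky.
have d't : exact_at d' t.
  move=> y; split=> [ty|[x <-]]; last exact: td'.
  have ky2 : y2 y = 0 by rewrite -kt ty raddf0.
  have [x dx] : exists x, d 1%N x = y1 y by apply/ddid; rewrite y12 ky2 raddf0.
  exists x; apply: kap_inj; rewrite kapd' [RHS]surjective_pairing.
  by rewrite -[(kap y).1]/(y1 y) -[(kap y).2]/(y2 y) -dx ky2.
have d2d' x : d' (d 2%N x) = 0.
  apply: kap_inj; rewrite kapd' raddf0 [d 1%N _](_ : _ = 0) ?raddf0 //.
  by apply/ddid; exists x.
split.
  (* Lift [z] to [y] in T Y. The component of [y] in T P vanishes, so the one in T (F 1) is a
     boundary; purity of the kernel of [phi] makes [y] itself come from F 2, and [t] kills it. *)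
  move=> T Ttest z kz.
  have [y ty] := rex_surj t_surj z.
  have y2y : rex_map T y2 y = 0.
    by rewrite -(@rex_comp _ T _ _ _ t k y2 kt) ty.
  have [v dv] : exists v, rex_map T (d 1%N) v = rex_map T y1 y.
    apply/(dd T Ttest); rewrite (@rex_comp2 T _ _ _ _ _ _ y2 s y12) y2y.
    exact: raddf0.
  have y0 : y - rex_map T d' v = 0.
    apply: (ker_pure (Fflat 0%N) kap_inj kap_phi phi_surj Ttest).
    rewrite (@rex_add _ T _ _ (lininl _ _ \o y1) (lininr _ _ \o y2) kap); last first.
      by move=> w; rewrite [LHS]surjective_pairing /= -[RHS]/(_ + 0, 0 + _) addr0 add0r.
    rewrite -(@rex_comp _ T _ _ _ y1 (lininl _ _)) //.
    rewrite -(@rex_comp _ T _ _ _ y2 (lininr _ _)) // !raddfB /=.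
    rewrite (@rex_comp _ T _ _ _ d' y1 (d 1%N) y1d') dv subrr add0r y2y.
    rewrite (@rex_comp0 T _ _ _ d' y2) ?subrr //.
    by move=> w; rewrite /y2 /= kapd'.
  rewrite -ty; move/subr0_eq: y0 => ->.
  exact: rex_comp0.
pose F' i := if i is j.+1 then F j.+2 else Y.
pose D i : {linear F' i.+1 -> F' i} :=
  match i return {linear F' i.+1 -> F' i} with 0%N => d' | j.+1 => d j.+2 end.
exists F', D, t; split=> // [[|i]|T Ttest [|i]];
  [by []|exact: Fflat| |exact: dd].
move=> x; split=> [d'x|[y <-]]; last exact: rex_comp0.
apply/(dd T Ttest); rewrite -(@rex_comp _ T _ _ _ d' y1 (d 1%N) y1d') d'x.
exact: raddf0.
Qed.

End Functors.

(** * Finite presentations *)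

Section Presented.
Variable R : pzRingType.
Implicit Types (C E F M N X Z : lmodType R) (I K S : finType).

Definition presents C I K (g : I -> C) (h : K -> I -> R) : Prop :=
  [/\ forall c, exists v : I -> R, c = \sum_i v i *: g i,
      forall k, lact h g k = 0 &
      forall v : I -> R, \sum_i v i *: g i = 0 ->
        exists w : K -> R, forall i, v i = \sum_k w k * h k i].

Definition presented C : Prop :=
  exists I K (g : I -> C) (h : K -> I -> R), presents g h.

Section Maps.
Variables (C : lmodType R) (I K : finType) (g : I -> C) (h : K -> I -> R).
Hypothesis gh : presents g h.

Lemma presents_lin_ext X (f f' : {linear C -> X}) :
  (forall i, f (g i) = f' (g i)) -> forall c, f c = f' c.
Proof.
move=> ff' c; have [gen _ _] := gh; have [v ->] := gen c.
by rewrite !linear_sum; apply: eq_bigr => i _; rewrite !linearZ /= ff'.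
Qed.

Lemma presents_lift X (f : I -> X) : (forall k, lact h f k = 0) ->
  exists u : {linear C -> X}, forall i, u (g i) = f i.
Proof.
move=> hf; have [gen hg rel] := gh.
have [|v cv|u uE] := @descend R _ _ _ (comb g) (comb f).
- move=> c; have [v ->] := gen c; exists [ffun i => v i : R^o].
  by apply: eq_bigr => i _; rewrite ffunE.
- have [w vw] := rel v cv.
  transitivity (\sum_k w k *: lact h f k); last first.
    by rewrite big1 // => k _; rewrite hf scaler0.
  rewrite /=; under eq_bigr do rewrite vw scaler_suml.
  rewrite exchange_big; apply: eq_bigr => k _; rewrite scaler_sumr.
  by apply: eq_bigr => i _; rewrite scalerA.
- by exists u => i; rewrite -(comb_unit g) uE comb_unit.
Qed.

(** The images of the generators satisfy [h]; trivialising these relations in the flat module gives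
    the matrix of [l]. *)
Lemma presents_factor F (phi : {linear C -> F}) : eflat F ->
  exists S (l : {linear C -> rows R S}) (f : S -> F),
    forall c, phi c = comb f (l c).
Proof.
move=> Fflat; have [_ hg _] := gh.
have [|S [rho [f [fE hrho]]]] := Fflat I K (phi \o g) h.
  by move=> k; rewrite -linear_lact hg raddf0.
have [|l lE] := @presents_lift (rows R S) (fun i => [ffun s => rho i s : R^o]).
  move=> k; apply/ffunP => s; rewrite /lact sum_ffunE ffunE -[RHS](hrho k s).
  by apply: eq_bigr => i _; rewrite !ffunE.
exists S, l, f; apply: (@presents_lin_ext _ phi (comb f \o l)) => i.
rewrite -[LHS]/((phi \o g) i) fE /= lE.
by apply: eq_bigr => s _; rewrite ffunE.
Qed.

End Maps.

Lemma finitely_presented_presented C : finitely_presented C -> presented C.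
Proof.
move=> [m [n [f [g [fg g_surj]]]]].
pose e (p : nat) (i : 'I_p) : 'rV[R]_p := delta_mx 0 i.
have eE p (v : 'rV[R]_p) : v = \sum_i v 0 i *: e p i by apply: row_sum_delta.
exists 'I_n, 'I_m, (fun i => g (e n i)), (fun k i => f (e m k) 0 i); split.
- move=> c; have [v <-] := g_surj c; exists (fun i => v 0 i).
  by rewrite {1}(eE n v) linear_sum; apply: eq_bigr => i _; rewrite linearZ.
- move=> k; transitivity (g (f (e m k))); last by apply/fg; exists (e m k).
  by rewrite (eE n (f _)) linear_sum; apply: eq_bigr => i _; rewrite linearZ.
- move=> v gv; have [w fw] : exists w, f w = \sum_i v i *: e n i.
    by apply/fg; rewrite linear_sum -[RHS]gv; apply: eq_bigr => i _; rewrite linearZ.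
  exists (fun k => w 0 k) => i.
  have -> : v i = (\sum_i v i *: e n i) 0 i.
    rewrite summxE (bigD1 i) //= !mxE !eqxx mulr1 big1 ?addr0 // => j ne.
    by rewrite !mxE [i == j]eq_sym (negPf ne) mulr0.
  rewrite -fw {1}(eE m w) linear_sum summxE; apply: eq_bigr => k _.
  by rewrite linearZ mxE.
Qed.

Lemma presented_coker C S (j : {linear C -> rows R S}) C' (q : {linear rows R S -> C'}) :
  presented C -> (forall y, exists x, q x = y) -> exact_at j q -> presented C'.
Proof.
move=> [I [K [g [h [gen _ _]]]]] q_surj jq.
have qE v : q v = \sum_s (v s : R) *: q (row_unit R s) := rows_linE q v.
exists S, I, (fun s => q (row_unit R s)), (fun i s => j (g i) s); split.
- by move=> c; have [v <-] := q_surj c; exists (fun s => v s).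
- by move=> i; rewrite -[LHS]qE; apply/jq; exists (g i).
- move=> v qv; have [c jc] : exists c, j c = [ffun s => v s : R^o].
    by apply/jq; rewrite qE -[RHS]qv; apply: eq_bigr => s _; rewrite ffunE.
  have [w cw] := gen c; exists w => s.
  have := congr1 (fun v : rows R S => v s) jc; rewrite ffunE => <-.
  by rewrite cw linear_sum sum_ffunE; apply: eq_bigr => i _; rewrite linearZ ffunE.
Qed.

(** * Preenvelopes of finitely presented modules *)

(** The preenvelope property tested on the ring alone; for finitely presented [C] it extends to all
    flat targets. *)
Definition dual_onto C N (j : {linear C -> N}) : Prop :=
  forall y : {linear C -> R^o}, exists u : {linear N -> R^o}, forall c, u (j c) = y c.

Lemma row_coord_linear S (s : S) : linear (fun v : rows R S => v s : R^o).
Proof. by move=> a v w; rewrite !ffunE. Qed.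
Definition row_coord S (s : S) : {linear rows R S -> R^o} :=
  mk_linear (row_coord_linear s).

Lemma rows_of_linear M S (f : S -> {linear M -> R^o}) :
  linear (fun x => [ffun s => f s x] : rows R S).
Proof. by move=> a x y; apply/ffunP => s; rewrite !ffunE linearP. Qed.
Definition rows_of M S (f : S -> {linear M -> R^o}) : {linear M -> rows R S} :=
  mk_linear (rows_of_linear f).

Lemma dual_onto_eflat C N (j : {linear C -> N}) F (f : {linear C -> F}) :
  presented C -> dual_onto j -> eflat F ->
  exists u : {linear N -> F}, forall c, u (j c) = f c.
Proof.
move=> [I [K [g [h gh]]]] j_onto Fflat.
have [S [l [f' fE]]] := presents_factor gh f Fflat.
pose u s := projT1 (cid (j_onto (row_coord s \o l))).
have uE s c : u s (j c) = l c s := projT2 (cid (j_onto (row_coord s \o l))) c.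
exists (comb f' \o rows_of u) => c; rewrite fE /=.
by apply: eq_bigr => s _; rewrite ffunE uE.
Qed.

(* For an injective right module [J], an element of [J (x) C] dying in
   [J (x) rows S] is a functional on a right module of columns that vanishes
   on the solutions of the relations of [C], hence factors through them. *)
Lemma dual_onto_tensor_inj C S (j : {linear C -> rows R S}) (J : lmodType R^c) :
  presented C -> dual_onto j -> injective_module J ->
  forall x, tensor_map (idfun : {linear J -> J}) j x = 0 -> x = 0.
Proof.
move=> [I [K [g [h gh]]]] j_onto Jinj x; have [gen hg rel] := gh.
have [a ->] : exists a : I -> J, x = \sum_i tens (a i) (g i).
  have [P [b [c ->]]] := tensor_sumE x.
  pose v p := projT1 (cid (gen (c p))).
  have cv p : c p = lact v g p := projT2 (cid (gen (c p))).
  by exists (ract v b); rewrite -tens_lact; apply: eq_bigr => p _; rewrite -cv.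
rewrite tensor_map_sum /= => ja.
have a0 s : ract (fun i s => j (g i) s) a s = 0.
  pose hs (b : J) (v : rows R S) := (v s : R^c) *: b.
  have := @tensor_eq_bal R J (rows R S) J hs I 'I_0 a (j \o g) (fun=> 0) (fun=> 0).
  rewrite !big_ord0 ja; apply=> // [v b c|b v w|r b v]; rewrite /hs.
  - by rewrite scalerBr.
  - by rewrite !ffunE scalerBl.
  - by rewrite ffunE scalerA.
pose al : {linear cols R I -> J} := mk_linear (comb_linear (R := R^c) a).
(* A column [v] with [h v = 0] is a functional on C, hence of the form [u \o j]. So [al v] is a
   combination of the coordinates [a0], and [al] factors through [h]. *)
have [v hv|be beE] := @injective_factor _ _ _ J (colmap h) al Jinj.
  have [|y yE] := presents_lift gh (f := fun i => v i : R^o).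
    move=> k; have := congr1 (fun w : cols R K => w k) hv.
    by rewrite ffunE [in RHS]ffunE.
  have [u uE] := j_onto y.
  have vE i : (v i : R) = \sum_s (j (g i) s : R) * u (row_unit R s).
    by rewrite -[LHS]yE -uE (rows_linE u).
  rewrite /al /=; under eq_bigr do rewrite vE scaler_suml.
  rewrite exchange_big big1 //= => s _.
  transitivity ((u (row_unit R s) : R^c) *: ract (fun i s => j (g i) s) a s).
    by rewrite scaler_sumr; apply: eq_bigr => i _; rewrite scalerA.
  by rewrite a0 scaler0.
have aE i : a i = ract h (fun k => be (col_unit R k)) i.
  have := beE (col_unit R i); rewrite colmap_unit linear_sum.
  rewrite [al _](@comb_unit R^c I J a i) => <-.
  by apply: eq_bigr => k _; rewrite linearZ.
under eq_bigr do rewrite aE; rewrite -tens_lact big1 // => k _.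
by rewrite hg tens0r.
Qed.

(** * Syzygies to the right *)

(* The complement [E] makes the class closed under cokernels of preenvelopes,
   although the flat modules in the resolution need not split off. *)
Definition flat_coresolved C : Prop :=
  exists (E Z : lmodType R) (F : nat -> lmodType R)
         (zeta : {linear Z -> (C * E)%type}) (om : {linear (C * E)%type -> F 0%N})
         (d : forall k, {linear F k -> F k.+1}),
    [/\ eflat E, eflat Z, forall k, eflat (F k) &
     forall T, testing T ->
       [/\ forall x, rex_map T zeta x = 0 -> x = 0,
           exact_at (rex_map T zeta) (rex_map T om),
           exact_at (rex_map T om) (rex_map T (d 0%N)) &
           forall k, exact_at (rex_map T (d k)) (rex_map T (d k.+1))]].

Section Preenvelope.
Variables (C E Z F : lmodType R).
Variables (zeta : {linear Z -> (C * E)%type}) (om : {linear (C * E)%type -> F}).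
Hypotheses (Cfp : presented C) (Zflat : eflat Z) (Fflat : eflat F).
Hypothesis zeta_mono : forall T, testing T -> forall x, rex_map T zeta x = 0 -> x = 0.
Hypothesis zeta_om : forall T, testing T -> exact_at (rex_map T zeta) (rex_map T om).

Let zeta_pure (I T : finType) (z : I -> Z) (la : I -> T -> R) (c : T -> (C * E)%type) :
  (forall i, zeta (z i) = lact la c i) ->
  exists s : T -> Z, forall i, z i = lact la s i.
Proof.
apply: eflat_pure => // J Jinj; exact: (zeta_mono (testing_tensor Jinj)).
Qed.

(** Such a [c] dies in every flat module, hence under [om], so [(c, 0)] is the image of some [z0].
    Purity of [zeta] gives a map C -> Z with value [z0] at [c]; as Z is flat, [z0 = 0]. *)
Lemma coresolved_torsionless c : (forall y : {linear C -> R^o}, y c = 0) -> c = 0.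
Proof.
have [I [K [g [h gh]]]] := Cfp; have [gen hg rel] := gh => yc.
have kill S (l : {linear C -> rows R S}) : l c = 0.
  by apply/ffunP => s; rewrite [RHS]ffunE; apply: (yc (row_coord s \o l)).
have killF X (f : {linear C -> X}) : eflat X -> f c = 0.
  move=> Xflat; have [S [l [f' fE]]] := presents_factor gh f Xflat.
  by rewrite fE kill raddf0.
have [z0 zz0] : exists z0, zeta z0 = lininl C E c.
  apply: (proj1 (zeta_om (testing_id R) (lininl C E c))).
  exact: (killF _ (om \o lininl C E)).
have [v cv] := gen c.
have [|sig sigE] := @zeta_pure ('I_1 + K)%type I (pad (fun=> z0) (fun=> 0))
    (pad (fun=> v) h) (fun i => lininl C E (g i)).
  case=> [o|k] /=.
    by rewrite zz0 cv linear_sum; apply: eq_bigr => i _; rewrite linearZ.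
  by rewrite raddf0 -[RHS](linear_lact (lininl C E) h g k) hg raddf0.
have [|th thE] := presents_lift gh (f := sig).
  by move=> k; apply: esym (sigE (inr k)).
have z00 : z0 = 0.
  rewrite -(killF _ th Zflat) cv linear_sum; apply: (etrans (sigE (inl ord0))).
  by apply: eq_bigr => i _; rewrite linearZ /= thE.
by have := congr1 fst zz0; rewrite z00 raddf0.
Qed.

(** Uniform exactness at C x E shows that a functional on C depends only on the image in [F] and on
    a map [th : C -> Z]. Both maps have flat targets, so they factor through finite free modules,
    whose sum is the target of [j]. *)
Lemma coresolved_preenvelope :
  exists S (j : {linear C -> rows R S}), dual_onto j /\ injective j.
Proof.
have [I [K [g [h gh]]]] := Cfp; have [gen hg rel] := gh.
have [S1 [l [phi omE]]] := presents_factor gh (om \o lininl C E) Fflat.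
have [| |K1 [S' [b [x [rho [pi [gE zxE seq]]]]]]] :=
    @uniform_exactness R R^o Z _ F zeta om (@eflat_regular R) _ I S1
      (fun i => lininl C E (g i)) (fun i s => l (g i) s) phi.
- by move=> J Jinj w; move/(zeta_om (testing_tensor Jinj)).
- by move=> i; apply: omE.
(* Two systems are solved in Z at once: [pi sig = x], so that [b - zeta sig] satisfies [pi], and
   [h rho sig = 0], so that [rho sig] defines the map [th]. *)
have [|sig sigE] := @zeta_pure (K1 + K)%type S' (pad x (fun=> 0))
    (pad pi (cmul h rho)) b.
  case=> [k|k] /=; first exact: zxE.
  rewrite raddf0 -[RHS]/(lact (cmul h rho) b k) lact_cmul.
  rewrite -(@eq_lact _ _ _ _ _ _ _ _ gE).
  by rewrite -[RHS](linear_lact (lininl C E) h g k) hg raddf0.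
have [|th thE] := presents_lift gh (f := lact rho sig).
  by move=> k; rewrite -lact_cmul; apply: esym (sigE (inr k)).
have [S2 [tau [psi thpsi]]] := presents_factor gh th Zflat.
pose j : {linear C -> rows R (S1 + S2)%type} :=
  rows_of (fun s => match s return {linear C -> R^o} with
                    | inl s => row_coord s \o l | inr s => row_coord s \o tau end).
have j_onto : dual_onto j.
  move=> y; pose y1 : {linear (C * E)%type -> R^o} := y \o linfst C E.
  (* The sequent holds over R, so [y] is evaluated on the solution [b - zeta sig]: on generators [y]
     is [u] applied to [l] plus [y1 \o zeta \o th]. *)
  have [k|u uE] := seq (fun s => y1 (b s - zeta (sig s))).
    rewrite -(linear_lact y1 pi (fun s => b s - zeta (sig s)) k) lactB -zxE.
    by rewrite -(linear_lact zeta) -[lact pi sig k](sigE (inl k)) subrr raddf0.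
  exists (comb (pad u (fun s => y1 (zeta (psi s))))).
  apply: (presents_lin_ext gh (f := comb _ \o j)) => i /=.
  rewrite sum_pad /=; under eq_bigr do rewrite ffunE.
  under [X in _ + X]eq_bigr do rewrite ffunE.
  rewrite -[X in X + _]uE.
  rewrite -(linear_lact y1 rho (fun s => b s - zeta (sig s)) i) lactB -gE.
  rewrite linearB -(linear_lact zeta) -thE thpsi -[y1 (lininl _ _ _)]/(y (g i)).
  rewrite -addrA addrC -[RHS]add0r; congr (_ + _); apply/eqP.
  rewrite addrC subr_eq0; apply/eqP.
  rewrite [RHS](linear_sum (y1 \o zeta)); apply: eq_bigr => s _.
  by rewrite linearZ.
exists (S1 + S2)%type, j; split=> // c c' jc; apply/subr0_eq.
apply: coresolved_torsionless => y; have [u <-] := j_onto y.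
by rewrite linearB jc subrr raddf0.
Qed.

End Preenvelope.

End Presented.

(** * Passing to the cokernel of a preenvelope *)

Section Coresolved.
Variable R : pzRingType.
Implicit Types (C E F L M N X Z : lmodType R) (I K S : finType) (T : rex_functor R).

Lemma rex_pairE T M N (w : T (M * N)%type) :
  w = rex_map T (lininl M N) (rex_map T (linfst M N) w) +
      rex_map T (lininr M N) (rex_map T (linsnd M N) w).
Proof.
rewrite (@rex_comp _ T _ _ _ _ _ (lininl M N \o linfst M N)) //.
rewrite (@rex_comp _ T _ _ _ _ _ (lininr M N \o linsnd M N)) //.
rewrite -(@rex_add _ T _ _ _ _ (idfun : {linear (M * N)%type -> (M * N)%type})).
  by rewrite rex_id.
by move=> x; rewrite /= [LHS]surjective_pairing -[RHS]/(_ + 0, 0 + _) addr0 add0r.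
Qed.

Lemma rex_pair_ext T M N (w w' : T (M * N)%type) :
  rex_map T (linfst M N) w = rex_map T (linfst M N) w' ->
  rex_map T (linsnd M N) w = rex_map T (linsnd M N) w' -> w = w'.
Proof. by move=> e1 e2; rewrite (rex_pairE w) (rex_pairE w') e1 e2. Qed.

Lemma rex_fst_pair T L M N (f : {linear L -> M}) (g : {linear L -> N}) x :
  rex_map T (linfst M N) (rex_map T (linpair f g) x) = rex_map T f x.
Proof. exact: rex_comp. Qed.

Lemma rex_snd_pair T L M N (f : {linear L -> M}) (g : {linear L -> N}) x :
  rex_map T (linsnd M N) (rex_map T (linpair f g) x) = rex_map T g x.
Proof. exact: rex_comp. Qed.

(** [eta] is pure by [eflat_pure], so relations in X lift to genuine relations in E after a
    correction by elements of Z, and can be trivialised there. *)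
Lemma eflat_coker Z E X (eta : {linear Z -> E}) (eps : {linear E -> X}) :
  eflat Z -> eflat E -> exact_at eta eps -> (forall y, exists x, eps x = y) ->
  (forall T, testing T -> forall x, rex_map T eta x = 0 -> x = 0) -> eflat X.
Proof.
move=> Zflat Eflat ee eps_surj eta_mono I K f c cf.
pose g i := projT1 (cid (eps_surj (f i))).
have gE i : eps (g i) = f i := projT2 (cid (eps_surj (f i))).
have kert k : exists z, eta z = lact c g k.
  by apply/ee; rewrite linear_lact -(cf k); apply: eq_lact => i; apply: gE.
pose t k := projT1 (cid (kert k)); have etat k : eta (t k) = _ := projT2 (cid (kert k)).
have [|s ts] := @eflat_pure R Z E eta Zflat _ K I t c g etat.
  by move=> J Jinj; apply: (eta_mono _ (testing_tensor Jinj)).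
have [|S [rho [f' [fE crho]]]] := Eflat I K (fun i => g i - eta (s i)) c.
  by move=> k; rewrite lactB -etat ts -(linear_lact eta) subrr.
exists S, rho, (eps \o f'); split=> // i.
rewrite -linear_lact -fE linearB gE.
by have -> : eps (eta (s i)) = 0 by [apply/ee; exists (s i)]; rewrite subr0.
Qed.

Section Cokernel.
Variables (C N C' : lmodType R) (j : {linear C -> N}) (q : {linear N -> C'}).
Hypotheses (Cfp : presented C) (Nproj : projective_module N) (j_onto : dual_onto j).
Hypothesis j_mono : forall T, testing T -> forall x, rex_map T j x = 0 -> x = 0.
Hypotheses (q_surj : forall y, exists x, q x = y) (jq : exact_at j q).

(** Extending [om] on C to [p : N -> F 0] and forming the mapping cone gives C' x F 0 -> F 1 -> F 2
    -> ..., with [F 0] as the new complement. The kernel Z' is the quotient of N x E by Z, hence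
    flat. *)
Lemma flat_coresolved_coker : flat_coresolved C -> flat_coresolved C'.
Proof.
move=> [E [Z [F [zeta [om [d [Eflat Zflat Fflat ex]]]]]]].
have [zeta_mono zeta_om om_d dd] := ex _ (testing_id R).
pose om1 : {linear C -> F 0%N} := om \o lininl C E.
pose om2 : {linear E -> F 0%N} := om \o lininr C E.
have omE c e : om (c, e) = om1 c + om2 e.
  rewrite /om1 /om2 /= -raddfD; congr (om _).
  by rewrite -[RHS]/(_ + 0, 0 + _) addr0 add0r.
have d_om x : d 0%N (om x) = 0 by apply/om_d; exists x.
have [p pj] := dual_onto_eflat om1 Cfp j_onto (Fflat 0%N).
have [|q' q'q] := descend (f := d 0%N \o p) q_surj.
  by move=> n /jq [c <-]; rewrite /= pj; apply: d_om.
pose om' : {linear (C' * F 0%N)%type -> F 1%N} :=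
  (d 0%N \o linsnd _ _) \- (q' \o linfst _ _).
have [Z' [zeta' [zeta'_inj zeta'_om']]] := ker_exists om'.
(* The image of [mu] is the kernel of [om'], and the kernel of [mu] is the image of Z under
   [eta]. *)
pose mu : {linear (N * E)%type -> (C' * F 0%N)%type} :=
  linpair (q \o linfst _ _) ((p \o linfst _ _) \+ (om2 \o linsnd _ _)).
pose jE : {linear (C * E)%type -> (N * E)%type} :=
  linpair (j \o linfst _ _) (linsnd _ _).
have qj c : q (j c) = 0 by apply/jq; exists c.
have mu_jE x : mu (jE x) = lininr _ _ (om x).
  by rewrite /mu /jE /= qj pj -omE -surjective_pairing.
have om'mu x : om' (mu x) = 0.
  rewrite /om' /mu /= q'q raddfD /= [d 0%N (om2 _)]d_om addr0 subrr //.
have [eps epsE] := ker_lift zeta'_inj zeta'_om' om'mu.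
pose eta : {linear Z -> (N * E)%type} := jE \o zeta.
have om_zeta z : om (zeta z) = 0 by apply/zeta_om; exists z.
have eps_eta z : eps (eta z) = 0.
  by apply: zeta'_inj; rewrite epsE -[eta z]/(jE (zeta z)) mu_jE om_zeta !raddf0.
have eps_surj z : exists x, eps x = z.
  have [n qn] := q_surj (zeta' z).1.
  have /zeta'_om' : exists z', zeta' z' = zeta' z by exists z.
  rewrite /om' /= -qn q'q /= => /eqP; rewrite -raddfB => /eqP/om_d [[c e] ce].
  exists (n + j c, e); apply: zeta'_inj; rewrite epsE /mu /= [RHS]surjective_pairing.
  rewrite !raddfD /= qj addr0 qn pj -addrA -omE ce.
  by rewrite addrC subrK.
have eta_eps : exact_at eta eps.
  move=> x; split=> [ex0|[z <-]]; last exact: eps_eta.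
  have := epsE x; rewrite ex0 raddf0 /mu /= => -[/esym/jq [c jc]].
  rewrite -jc pj -omE => /esym/zeta_om [z zz]; exists z.
  by rewrite /eta /jE /= zz /= jc -surjective_pairing.
have eta_mono T : testing T -> forall z, rex_map T eta z = 0 -> z = 0.
  move=> Tt z ez; have [zm _ _ _] := ex T Tt; apply: zm.
  have jEz : rex_map T jE (rex_map T zeta z) = 0.
    by rewrite (@rex_comp _ T _ _ _ _ _ eta).
  apply: rex_pair_ext; rewrite raddf0.
    apply: (j_mono Tt); rewrite (@rex_comp _ T _ _ _ _ _ (j \o linfst _ _)) //.
    by rewrite -(rex_fst_pair (j \o linfst _ _) (linsnd _ _)) jEz raddf0.
  by rewrite -(rex_snd_pair (j \o linfst _ _) (linsnd _ _)) jEz raddf0.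
have Z'flat : eflat Z'.
  apply: (eflat_coker Zflat _ eta_eps eps_surj eta_mono).
  by apply: eflat_prod => //; apply: projective_eflat.
have d_q' x : d 1%N (q' x) = 0.
  have [n <-] := q_surj x; rewrite q'q /=; apply/dd; by exists (p n).
exists (F 0%N), Z', (fun k => F k.+1), zeta', om', (fun k => d k.+1).
split=> // T Tt; have [zm zo od ddT] := ex T Tt.
have Tom x : rex_map T om x = rex_map T om1 (rex_map T (linfst _ _) x) +
    rex_map T om2 (rex_map T (linsnd _ _) x).
  rewrite {1}(rex_pairE x) raddfD /=.
  by rewrite (@rex_comp _ T _ _ _ _ _ om1) // (@rex_comp _ T _ _ _ _ _ om2).
have Tmu1 y : rex_map T (linfst _ _) (rex_map T mu y) =
    rex_map T q (rex_map T (linfst _ _) y).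
  by rewrite rex_fst_pair (@rex_comp _ T _ _ _ _ _ (q \o linfst _ _)).
have Tmu2 y : rex_map T (linsnd _ _) (rex_map T mu y) =
    rex_map T p (rex_map T (linfst _ _) y) + rex_map T om2 (rex_map T (linsnd _ _) y).
  rewrite rex_snd_pair (@rex_comp _ T _ _ _ _ _ (p \o linfst _ _)) //.
  rewrite (@rex_comp _ T _ _ _ _ _ (om2 \o linsnd _ _)) //.
  exact: rex_add.
have Tom' w : rex_map T om' w = rex_map T (d 0%N) (rex_map T (linsnd _ _) w) -
    rex_map T q' (rex_map T (linfst _ _) w).
  apply/eqP; rewrite eq_sym subr_eq; apply/eqP.
  rewrite (@rex_comp _ T _ _ _ _ _ (d 0%N \o linsnd _ _)) //.
  rewrite (@rex_comp _ T _ _ _ _ _ (q' \o linfst _ _)) //.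
  by apply: rex_add => x; rewrite /om' /= subrK.
have Teps y : rex_map T zeta' (rex_map T eps y) = rex_map T mu y by apply: rex_comp.
have pjT c : rex_map T p (rex_map T j c) = rex_map T om1 c by apply: rex_comp.
have jqT := rex_exact jq q_surj (r := T).
have omd0 w : rex_map T (d 0%N) (rex_map T om w) = 0 by apply: rex_comp0.
split.
(* Since [mu] kills the lift [y], its N-component comes from some [c], and the element [w] with
   components [c] and the E-component of [y] dies under [om]. Hence [w] comes from Z, so [y] is in
   the image of [eta]. *)
- move=> z zz; have [y ey] := rex_surj eps_surj z.
  have muy : rex_map T mu y = 0 by rewrite -Teps ey.
  have [c jc] : exists c, rex_map T j c = rex_map T (linfst _ _) y.
    by apply/jqT; rewrite -Tmu1 muy raddf0.
  pose w := rex_map T (lininl C E) c +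
    rex_map T (lininr C E) (rex_map T (linsnd _ _) y).
  have w1 : rex_map T (linfst _ _) w = c.
    rewrite raddfD /= (@rex_comp _ T _ _ _ _ _ idfun) // rex_id //.
    by rewrite rex_comp0 ?addr0.
  have w2 : rex_map T (linsnd _ _) w = rex_map T (linsnd _ _) y.
    rewrite raddfD /= rex_comp0 // add0r (@rex_comp _ T _ _ _ _ _ idfun) //.
    by rewrite rex_id.
  have [z1 z1w] : exists z1, rex_map T zeta z1 = w.
    by apply/zo; rewrite Tom w1 w2 -pjT jc -Tmu2 muy raddf0.
  have -> : z = rex_map T eps (rex_map T eta z1).
    rewrite -ey; congr (rex_map T eps _); rewrite -(@rex_comp _ T _ _ _ zeta jE) //.
    rewrite z1w; apply: rex_pair_ext.
      by rewrite rex_fst_pair -(@rex_comp _ T _ _ _ (linfst _ _) j) // w1 jc.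
    by rewrite rex_snd_pair w2.
  exact: rex_comp0.
- move=> w; split=> [w0|[z <-]]; last first.
    by apply: rex_comp0 => z'; apply/zeta'_om'; exists z'.
  have [n qn] := rex_surj q_surj (rex_map T (linfst _ _) w).
  have [v vE] : exists v, rex_map T om v =
      rex_map T (linsnd _ _) w - rex_map T p n.
    apply/od; rewrite raddfB /= (@rex_comp _ T _ _ _ p _ (d 0%N \o p)) //.
    by rewrite -(@rex_comp _ T _ _ _ q q') // qn -Tom'.
  pose y := rex_map T (lininl N E) n + rex_map T jE v.
  exists (rex_map T eps y); rewrite Teps /y raddfD /=.
  have y1 : rex_map T (linfst _ _) (rex_map T (lininl N E) n) = n.
    by rewrite (@rex_comp _ T _ _ _ _ _ idfun) // rex_id.
  have y2 : rex_map T (linsnd _ _) (rex_map T (lininl N E) n) = 0.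
    exact: rex_comp0.
  rewrite (@rex_comp2 R T _ _ _ _ jE mu om (lininr _ _)) //.
  apply: rex_pair_ext; rewrite raddfD /=.
    by rewrite Tmu1 y1 qn rex_comp0 ?addr0.
  rewrite Tmu2 y1 y2 raddf0 addr0 (@rex_comp _ T _ _ _ _ _ idfun) // rex_id //.
  by rewrite vE addrC subrK.
- move=> x; split=> [dx|[w <-]]; last first.
    rewrite Tom' raddfB /= rex_comp0 ?rex_comp0 ?subr0 // => y.
    by apply/dd; exists y.
  have [x0 <-] : exists x0, rex_map T (d 0%N) x0 = x by apply/ddT.
  exists (rex_map T (lininr _ _) x0); apply: rex_comp => y.
  by rewrite /om' /= raddf0 subr0.
- by move=> k; apply: ddT.
Qed.

End Cokernel.

Lemma coresolved_step C : presented C -> flat_coresolved C ->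
  exists (N C' : lmodType R) (j : {linear C -> N}) (q : {linear N -> C'}),
    [/\ [/\ projective_module N, forall y, exists x, q x = y & exact_at j q],
        forall T, testing T -> forall x, rex_map T j x = 0 -> x = 0,
        dual_onto j, presented C' & flat_coresolved C'].
Proof.
move=> Cfp Cres; have [E [Z [F [zeta [om [d [Eflat Zflat Fflat ex]]]]]]] := Cres.
have [||S [j [j_onto j_inj]]] :=
  @coresolved_preenvelope R C E Z _ zeta om Cfp Zflat (Fflat 0%N).
- by move=> T /ex [].
- by move=> T /ex [].
have j_mono T : testing T -> forall x, rex_map T j x = 0 -> x = 0.
  move=> [|J Jinj] x; last exact: dual_onto_tensor_inj.
  by rewrite -[RHS](raddf0 j) => /j_inj.
have [C' [q [q_surj jq]]] := coker_exists j.
have Nproj : projective_module (rows R S).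
  move=> A B p f p_surj; pose s y := projT1 (cid (p_surj y)).
  have ps y : p (s y) = y := projT2 (cid (p_surj y)).
  exists (comb (fun i => s (f (row_unit R i)))) => x.
  rewrite (rows_linE f) /= linear_sum; apply: eq_bigr => i _.
  by rewrite linearZ /= ps.
exists (rows R S), C', j, q; split=> //.
  exact: presented_coker jq.
exact: (flat_coresolved_coker Cfp Nproj j_onto j_mono q_surj jq).
Qed.

End Coresolved.

(** * Biduals *)

Section RightCharacters.
Variables (R : pzRingType) (J : lmodType R^c).

Record rchars := RChars { rchars_val :> J -> QmodZ; rcharsB : zmod_morphism rchars_val }.

Lemma rchars_ext (f g : rchars) : (forall x, f x = g x) -> f = g.
Proof.
case: f g => [f hf] [g hg] /= /funext E.
by move: hf hg; rewrite E => hf hg; congr RChars; apply: Prop_irrelevance.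
Qed.

HB.instance Definition _ := gen_eqMixin rchars.
HB.instance Definition _ := gen_choiceMixin rchars.

Fact rchars_zeroB : zmod_morphism (fun _ : J => 0 : QmodZ).
Proof. by move=> y z; rewrite subrr. Qed.
Fact rchars_oppB (f : rchars) : zmod_morphism (fun y => - f y).
Proof. by move=> y z; rewrite rcharsB opprB opprK addrC. Qed.
Fact rchars_addB (f g : rchars) : zmod_morphism (fun y => f y + g y).
Proof. by move=> y z; rewrite !rcharsB opprD addrACA. Qed.
Fact rchars_scaleB (r : R) (f : rchars) : zmod_morphism (fun y => f ((r : R^c) *: y)).
Proof. by move=> y z; rewrite scalerBr rcharsB. Qed.

Let zero := RChars rchars_zeroB.
Let opp f := RChars (rchars_oppB f).
Let add f g := RChars (rchars_addB f g).
Let scale (r : R) f := RChars (rchars_scaleB r f).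

Fact rchars_addA : associative add.
Proof. by move=> f g h; apply: rchars_ext => x; apply: addrA. Qed.
Fact rchars_addC : commutative add.
Proof. by move=> f g; apply: rchars_ext => x; apply: addrC. Qed.
Fact rchars_add0 : left_id zero add.
Proof. by move=> f; apply: rchars_ext => x; apply: add0r. Qed.
Fact rchars_addN : left_inverse zero opp add.
Proof. by move=> f; apply: rchars_ext => x; apply: addNr. Qed.

HB.instance Definition _ :=
  GRing.isZmodule.Build rchars rchars_addA rchars_addC rchars_add0 rchars_addN.

Fact rchars_scaleA r s f : scale r (scale s f) = scale (r * s) f.
Proof. by apply: rchars_ext => x /=; rewrite scalerA. Qed.
Fact rchars_scale1 : left_id 1 scale.
Proof. by move=> f; apply: rchars_ext => x /=; rewrite scale1r. Qed.
Fact rchars_scaleDr : right_distributive scale +%R.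
Proof. by move=> r f g; apply: rchars_ext. Qed.
Fact rchars_scaleDl f : {morph scale^~ f : r s / r + s}.
Proof.
move=> r s; apply: rchars_ext => x /=; rewrite scalerDl.
exact: (raddfD (mk_additive (@rcharsB f))).
Qed.

HB.instance Definition _ := GRing.Zmodule_isLmodule.Build R rchars
  rchars_scaleA rchars_scale1 rchars_scaleDr rchars_scaleDl.

Lemma rchars_raddf0 (f : rchars) : f 0 = 0.
Proof. exact: (raddf0 (mk_additive (@rcharsB f))). Qed.

Lemma rchars_sum_val (I : finType) (F : I -> rchars) x :
  (\sum_i F i) x = \sum_i F i x.
Proof.
elim: (index_enum I) => [|i r IH]; first by rewrite !big_nil.
by rewrite !big_cons -IH.
Qed.

Lemma rchars_raddf_sum (f : rchars) (I : finType) (F : I -> J) :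
  f (\sum_i F i) = \sum_i f (F i).
Proof. exact: (raddf_sum (mk_additive (@rcharsB f))). Qed.

Lemma rchars_lact_ract (I S : finType) (c : I -> S -> R) (y : S -> rchars) (a : I -> J) :
  \sum_i lact c y i (a i) = \sum_s y s (ract c a s).
Proof.
under [RHS]eq_bigr do rewrite rchars_raddf_sum; rewrite [RHS]exchange_big /=.
by apply: eq_bigr => i _; rewrite /lact rchars_sum_val.
Qed.

End RightCharacters.

Section Bidual.
Variables (R : pzRingType) (Y : lmodType R).

Definition bidual : lmodType R := rchars (chars unit Y).

Lemma bidual_evB (y : Y) : zmod_morphism (fun chi : chars unit Y => chi tt y).
Proof. by []. Qed.

Lemma bidual_ev_linear : linear (fun y => RChars (bidual_evB y) : bidual).
Proof.
move=> r y z; apply: rchars_ext => chi.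
rewrite -[RHS]/(chi tt (r *: y) + chi tt z).
exact: (raddfD (mk_additive (@charsB _ _ _ chi tt))).
Qed.
Definition bidual_ev : {linear Y -> bidual} := mk_linear bidual_ev_linear.

Lemma bidual_ev_inj : injective bidual_ev.
Proof.
move=> y z E; apply/subr0_eq; apply: contrapT => yz.
have [|F [_ Fyz]] := @character_sep Y Y (linzero Y Y) (y - z).
  by move=> [s /= s0]; rewrite -s0 in yz.
apply: Fyz; pose chi : chars unit Y := Chars (fun _ : unit => raddfB F).
rewrite raddfB; apply/eqP; rewrite subr_eq0; apply/eqP.
exact: (congr1 (fun b : bidual => b chi) E).
Qed.

Variables (I K S T : finType) (rho : I -> S -> R) (pi : K -> S -> R) (la : I -> T -> R).

Lemma sequent_dual : sequent Y rho pi la ->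
  forall chi : I -> chars unit Y, (forall t, ract la chi t = 0) ->
  exists al : K -> chars unit Y, forall s, ract rho chi s = ract pi al s.
Proof.
move=> seq chi chi_la.
pose pi' (v : {ffun S -> Y}) : {ffun K -> Y} := [ffun k => lact pi v k].
have pi'B : zmod_morphism pi'.
  move=> v w; apply/ffunP => k; rewrite !ffunE -lactB.
  by apply: eq_lact => s; rewrite !ffunE.
pose Phi (v : {ffun S -> Y}) := \sum_i chi i tt (lact rho v i).
have PhiE v : Phi v = \sum_s ract rho chi s tt (v s) by apply: chars_ract_lact.
have PhiB : zmod_morphism Phi.
  by move=> v w; rewrite !PhiE -sumrB; apply: eq_bigr => s _; rewrite !ffunE charsB.
have [v /= piv|F FE] := @character_ext _ _ (mk_additive pi'B) (mk_additive PhiB).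
  have [k|u uE] := seq v.
    by have := congr1 (fun w : {ffun K -> Y} => w k) piv; rewrite !ffunE.
  rewrite /Phi; under eq_bigr do rewrite uE.
  by rewrite chars_ract_lact big1 // => t _; rewrite chi_la.
have [al [alB FalE]] := ffun_character F.
exists (fun k => Chars (fun _ : unit => alB k)) => s.
apply: chars_ext => -[] y.
pose v : {ffun S -> Y} := [ffun s' => if s' == s then y else 0].
have vE (x : S -> chars unit Y) : \sum_s' x s' tt (v s') = x s tt y.
  rewrite /v; under eq_bigr do rewrite ffunE.
  by apply: (@sum_delta _ _ _ (fun s' => x s' tt)) => s'; apply: chars_raddf0.
rewrite -vE -PhiE -[Phi v]FE FalE -vE -chars_ract_lact.
by apply: eq_bigr => k _; rewrite ffunE.
Qed.

(** The argument of [sequent_dual] once more, applied to the dual sequent. *)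
Lemma sequent_bidual : sequent Y rho pi la -> sequent bidual rho pi la.
Proof.
move=> seq y piy.
pose la' (chi : {ffun I -> chars unit Y}) : {ffun T -> chars unit Y} :=
  [ffun t => ract la chi t].
have la'B : zmod_morphism la'.
  move=> v w; apply/ffunP => t; rewrite !ffunE -ractB.
  by apply: eq_ract => i; rewrite !ffunE.
pose Phi (chi : {ffun I -> chars unit Y}) := \sum_s y s (ract rho chi s).
have PhiE chi : Phi chi = \sum_i lact rho y i (chi i) by rewrite rchars_lact_ract.
have PhiB : zmod_morphism Phi.
  by move=> v w; rewrite !PhiE -sumrB; apply: eq_bigr => i _; rewrite !ffunE rcharsB.
have [chi /= lachi|F FE] := @character_ext _ _ (mk_additive la'B) (mk_additive PhiB).
  have [t|al alE] := sequent_dual seq (chi := chi).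
    have := congr1 (fun w : {ffun T -> chars unit Y} => w t) lachi.
    by rewrite ffunE [in RHS]ffunE.
  rewrite /Phi; under eq_bigr do rewrite alE.
  by rewrite -rchars_lact_ract big1 // => k _; rewrite piy.
have [u [uB FuE]] := ffun_character F.
exists (fun t => RChars (uB t)) => i; apply: rchars_ext => x.
pose chi : {ffun I -> chars unit Y} := [ffun i' => if i' == i then x else 0].
have chiE (b : I -> bidual) : \sum_i' b i' (chi i') = b i x.
  rewrite /chi; under eq_bigr do rewrite ffunE.
  by apply: (@sum_delta _ _ _ (fun i' => b i' : _ -> _)) => i'; apply: rchars_raddf0.
rewrite -chiE -PhiE -[Phi chi]FE FuE -chiE rchars_lact_ract.
by apply: eq_bigr => t _; rewrite ffunE.
Qed.

(** Purity of Y in its bidual lifts a solution in D to an exact solution in the bidual, where the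
    sequent is known. *)
Lemma sequent_bidual_coker (D : lmodType R) (q : {linear bidual -> D}) :
  (forall y, exists x, q x = y) -> exact_at bidual_ev q ->
  sequent Y rho pi la -> sequent D rho pi la.
Proof.
move=> q_surj evq /sequent_bidual seq y piy.
pose z s := projT1 (cid (q_surj (y s))).
have qz s : q (z s) = y s := projT2 (cid (q_surj (y s))).
have kerv k : exists v, bidual_ev v = lact pi z k.
  by apply/evq; rewrite linear_lact -(piy k); apply: eq_lact => s; apply: qz.
pose v k := projT1 (cid (kerv k)).
have vE k : bidual_ev (v k) = lact pi z k := projT2 (cid (kerv k)).
(* A family of characters [chi] that kills [pi] also kills [v], because [chi v] is [pi z] evaluated
   at [chi], that is [z] evaluated at [chi pi = 0]. *)
have [w wE] : exists w : S -> Y, forall k, v k = lact pi w k.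
  pose pi' (x : {ffun S -> Y}) : {ffun K -> Y} := [ffun k => lact pi x k].
  have pi'B : zmod_morphism pi'.
    move=> x x'; apply/ffunP => k; rewrite !ffunE -lactB.
    by apply: eq_lact => s; rewrite !ffunE.
  apply: contrapT => nw.
  have [|F [Fpi Fv]] := @character_sep _ _ (mk_additive pi'B) [ffun k => v k].
    move=> [x xE]; apply: nw; exists x => k.
    by have := congr1 (fun h : {ffun K -> Y} => h k) xE; rewrite !ffunE.
  have [chi0 [chiB FE]] := ffun_character F.
  pose chi k : chars unit Y := Chars (fun _ : unit => chiB k).
  have pichi s : ract pi chi s = 0.
    apply: chars_ext => -[] x.
    pose x' : {ffun S -> Y} := [ffun s' => if s' == s then x else 0].
    transitivity (F (pi' x')); last exact: Fpi.
    transitivity (\sum_s' ract pi chi s' tt (x' s')).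
      rewrite /x'; under eq_bigr do rewrite ffunE.
      rewrite (@sum_delta _ _ _ (fun s' => ract pi chi s' tt)) // => s'.
      exact: chars_raddf0.
    by rewrite FE -chars_ract_lact; apply: eq_bigr => k _; rewrite ffunE.
  apply: Fv; rewrite FE.
  transitivity (\sum_k lact pi z k (chi k)).
    by apply: eq_bigr => k _; rewrite ffunE -vE.
  by rewrite rchars_lact_ract big1 // => s _; rewrite pichi rchars_raddf0.
have [k|u uE] := seq (fun s => z s - bidual_ev (w s)).
  by rewrite lactB -vE wE (linear_lact bidual_ev) subrr.
exists (q \o u) => i; rewrite -linear_lact -uE lactB linearB.
rewrite -(linear_lact bidual_ev).
have -> : q (bidual_ev (lact rho w i)) = 0 by apply/evq; exists (lact rho w i).
by rewrite subr0 linear_lact; apply: eq_lact => s; rewrite /= qz.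
Qed.

End Bidual.

(** * Vanishing of extensions along a projective resolution *)

Section Vanishing.
Variables (R : pzRingType) (K P : nat -> lmodType R).
Implicit Types (Y D Q : lmodType R).
Variables (a : forall k, {linear K k.+1 -> P k}) (p : forall k, {linear P k -> K k}).
Hypotheses (K0fp : presented (K 0%N)) (Pproj : forall k, projective_module (P k)).
Hypotheses (p_surj : forall k y, exists x, p k x = y) (ap : forall k, exact_at (a k) (p k)).
Hypothesis a_inj : forall k, injective (a k).
Hypothesis a_mono : forall k (J : lmodType R^c), injective_module J ->
  forall x, tensor_map (idfun : {linear J -> J}) (a k) x = 0 -> x = 0.

(* A form of Tor-vanishing against the definable closure of the character
   module of [Y]; unlike flatness of [Y], it survives passing to biduals. *)
Let solvable (Y : lmodType R) : Prop :=
  forall k (I T : finType) (b : I -> K k.+1) (la : I -> T -> R) (c : T -> P k),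
    (forall i, a k (b i) = lact la c i) ->
    exists (L S : finType) (b' : S -> K k.+1) (rho : I -> S -> R) (pi : L -> S -> R),
      [/\ forall i, b i = lact rho b' i, forall l, lact pi b' l = 0 &
          sequent Y rho pi la].

Let eflat_solvable Y : eflat Y -> solvable Y.
Proof.
move=> Yflat k I T b la c ab.
have [|L [S [b' [x [rho [pi [bE piE seq]]]]]]] :=
    @uniform_exactness R Y (K k.+1) _ _ (linzero _ _) (a k) Yflat _ I T b la c ab.
  by move=> J Jinj x /(a_mono Jinj) ->; exists 0; rewrite raddf0.
by exists L, S, b', rho, pi; split=> // l; rewrite -piE.
Qed.

Let bidual_solvable Y : solvable Y -> solvable (bidual Y).
Proof.
move=> solY k I T b la c /solY [L [S [b' [rho [pi [bE piE seq]]]]]].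
by exists L, S, b', rho, pi; split=> //; apply: sequent_bidual.
Qed.

Let coker_solvable Y D (q : {linear bidual Y -> D}) :
  (forall y, exists x, q x = y) -> exact_at (bidual_ev Y) q -> solvable Y -> solvable D.
Proof.
move=> q_surj evq solY k I T b la c /solY [L [S [b' [rho [pi [bE piE seq]]]]]].
by exists L, S, b', rho, pi; split=> //; apply: sequent_bidual_coker evq seq.
Qed.

(** As [P k] is projective, this is the vanishing of Ext^1 (K k, Y), which is Ext^(k+1) (K 0, Y). *)
Let extends k Y : Prop :=
  forall f : {linear K k.+1 -> Y}, exists g : {linear P k -> Y}, forall x, g (a k x) = f x.

(** With [s] lifting the generators of K 0, the relations [h s] come from elements [b] of K 1. The
    values of [f] satisfy the premise of the sequent, so [f b = h u], and [u] can be taken as the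
    values at [s]. *)
Let extends0 Y : solvable Y -> extends 0 Y.
Proof.
move=> solY f; have [I [L [g [h [gen hg rel]]]]] := K0fp.
pose s i := projT1 (cid (p_surj (g i))).
have ps i : p 0 (s i) = g i := projT2 (cid (p_surj (g i))).
have kerb l : exists x, a 0 x = lact h s l.
  by apply/ap; rewrite linear_lact -(hg l); apply: eq_lact => i; apply: ps.
pose b l := projT1 (cid (kerb l)); have ab l : a 0 (b l) = _ := projT2 (cid (kerb l)).
have [L' [S [b' [rho [pi [bE piE seq]]]]]] := solY _ _ _ b h s ab.
have [l|u uE] := seq (f \o b'); first by rewrite -linear_lact piE raddf0.
have fb l : f (b l) = lact h u l by rewrite -uE -linear_lact bE.
(* [P 0] is generated by the lifts [s] and by K 1, so it is a quotient by [A]; [B] prescribes the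
   extension on these generators. *)
pose A : {linear (rows R I * K 1%N)%type -> P 0%N} :=
  (comb s \o linfst _ _) \+ (a 0 \o linsnd _ _).
pose B : {linear (rows R I * K 1%N)%type -> Y} :=
  (comb u \o linfst _ _) \+ (f \o linsnd _ _).
have [x|[v x]|G GE] := @descend R _ _ _ A B.
- have [v vE] := gen (p 0 x).
  have [y ay] : exists y, a 0 y = x - comb s [ffun i => v i : R^o].
    apply/ap; rewrite linearB vE [X in _ - X]linear_sum; apply/eqP.
    rewrite subr_eq0; apply/eqP/eq_bigr => i _.
    by rewrite linearZ ffunE /= ps.
  by exists ([ffun i => v i : R^o], y); rewrite /A /= ay addrC subrK.
- rewrite /A /B /= => /eqP; rewrite addr_eq0 => /eqP sv.
  have [w wE] : exists w : L -> R, forall i, v i = \sum_l w l * h l i.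
    apply: rel; transitivity (p 0 (comb s v)).
      rewrite [RHS]linear_sum; apply: eq_bigr => i _; by rewrite linearZ /= ps.
    by rewrite /= sv; apply/ap; exists (- x); rewrite raddfN.
  have swap (X : lmodType R) (y : I -> X) :
      \sum_i (v i : R) *: y i = \sum_l w l *: lact h y l.
    under eq_bigr do rewrite wE scaler_suml; rewrite exchange_big.
    apply: eq_bigr => l _; rewrite scaler_sumr.
    by apply: eq_bigr => i _; rewrite scalerA.
  have -> : x = - \sum_l w l *: b l.
    apply: (a_inj (k := 0)); rewrite linearN linear_sum -[LHS]opprK -sv swap.
    by congr (- _); apply: eq_bigr => l _; rewrite linearZ /= ab.
  rewrite swap linearN linear_sum -sumrB big1 // => l _.
  by rewrite linearZ /= fb subrr.
- by exists G => x; have := GE (0, x); rewrite /A /B /= !big1 ?add0r // => i _;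
    rewrite ffunE scale0r.
Qed.

(** Maps to the bidual are characters of J (x) -, where J is the character module of Y, so they
    extend once J (x) [a k] is injective. *)
Let extends_bidual k Y : solvable Y -> extends k (bidual Y).
Proof.
move=> solY f; pose J := chars unit Y.
have [|chi|r chi m|H HE] := @tensor_lift R J (K k.+1) QmodZ (fun chi m => f m chi).
- by move=> m; apply: rcharsB.
- by move=> m m'; rewrite linearB.
- by rewrite linearZ.
have inj z : tensor_map (idfun : {linear J -> J}) (a k) z = 0 -> z = 0.
  have [I [chi [b ->]]] := tensor_sumE z; rewrite tensor_map_sum /=.
  (* Adjoining zeros to [b] and the [- al l] to [chi] gives a family of characters killing the
     stacked matrix of [la] and [mu]. By the dual sequent it satisfies [chi rho = be pi], and [pi]
     kills [b']. *)
  move=> /tens_sum0P [L [T [al [c [la [mu [abE muc laE]]]]]]].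
  have [|M [S [b' [rho [pi [bE piE seq]]]]]] :=
      solY k (I + L)%type T (pad b (fun=> 0)) (pad la mu) c.
    case=> [i|l] /=; first exact: abE.
    by rewrite raddf0 -[LHS](muc l).
  have [t|be beE] := sequent_dual seq (chi := pad chi (fun l => - al l)).
    rewrite /ract sum_pad /=; under [X in _ + X]eq_bigr do rewrite scalerN.
    by rewrite sumrN; apply/eqP; rewrite subr_eq0; apply/eqP/laE.
  transitivity (\sum_x tens (pad chi (fun l => - al l) x) (pad b (fun=> 0) x)).
    by rewrite sum_pad /= [X in _ + X]big1 ?addr0 // => l _; rewrite tens0r.
  under eq_bigr do rewrite bE; rewrite tens_lact.
  under eq_bigr do rewrite beE; rewrite -tens_lact big1 // => l _.
  by rewrite piE tens0r.
pose A : {additive tensor J (K k.+1) -> tensor J (P k)} :=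
  tensor_map (idfun : {linear J -> J}) (a k).
have [z /inj ->|F FE] := @character_ext _ _ A H; first exact: raddf0.
have gB x : zmod_morphism (fun chi : J => F (tens chi x)).
  move=> chi chi'; rewrite -raddfB; congr (F _).
  by rewrite tensDl tensNl.
have g_lin : linear (fun x => RChars (gB x) : bidual Y).
  move=> r x y; apply: rchars_ext => chi /=; rewrite tensDr raddfD.
  by rewrite -(@tensZ R).
exists (mk_linear g_lin) => x; apply: rchars_ext => chi /=.
by rewrite -HE -FE /A /= tensor_map_tens.
Qed.

Lemma ext_vanishing Q : eflat Q ->
  forall k (f : {linear K k.+1 -> Q}), exists g : {linear P k -> Q},
    forall x, g (a k x) = f x.
Proof.
move=> /eflat_solvable + k; elim: k Q => [|k IH] Y solY; first exact: extends0.
move=> f; have [D [q [q_surj evq]]] := coker_exists (bidual_ev Y).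
(* An extension exists in the bidual. Its class in D descends to K (k+1), extends to [P k] by
   induction and lifts to the bidual; subtracting the lift moves the extension into Y. *)
have [g gE] := extends_bidual solY (bidual_ev Y \o f).
have [|fD fDE] := descend (f := q \o g) (p_surj (k := k.+1)).
  by move=> x /ap [y <-]; rewrite /= gE; apply/evq; exists (f y).
have [h hE] := IH D (coker_solvable q_surj evq solY) fD.
have [u uE] := @Pproj k _ _ q h q_surj.
pose g' : {linear P k.+1 -> bidual Y} := g \- (u \o (a k \o p k.+1)).
have [|G GE] := @ker_lift R _ _ _ _ (bidual_ev Y) q g' (@bidual_ev_inj R Y) evq.
  by move=> x; rewrite /g' /= linearB uE hE fDE subrr.
exists G => x; apply: (@bidual_ev_inj R Y); rewrite GE /g' /= gE /=.
have -> : p k.+1 (a k.+1 x) = 0 by apply/ap; exists x.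
by rewrite !raddf0 ?subr0 ?addr0.
Qed.

End Vanishing.

(** * Complexes *)

Section Resolutions.
Variables (R : pzRingType) (X : complex R).
Hypothesis Xtot : F_totally_acyclic X.

Lemma testing_exact T : testing T ->
  forall i, exact_at (rex_map T (diff X (i + 1))) (rex_map T (diff X i)).
Proof. by case: Xtot => _ acy tacy [|J Jinj] i; [exact: acy | exact: tacy]. Qed.

(** Descending indices need a differential from degree n to n - 1, where n - 1 + 1 and n are only
    propositionally equal. *)
Definition cast_diff (i j : int) (e : i + 1 = j) : {linear X j -> X i} :=
  match e in _ = j return {linear X j -> X i} with erefl => diff X i end.

Lemma cast_diff_exact T (i j l : int) (e : i + 1 = j) (e' : j + 1 = l) : testing T ->
  exact_at (rex_map T (cast_diff e')) (rex_map T (cast_diff e)).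
Proof. by move=> Tt; case: _ / e' ; case: _ / e; apply: testing_exact. Qed.

Variables (M : lmodType R) (i : int) (f : {linear M -> X i}).
Hypothesis f_inj : injective f.
Hypothesis f_im : forall y, (exists m, f m = y) <-> (exists x, diff X i x = y).

Let eflatX k : eflat (X k).
Proof. by case: Xtot => Xflat _ _; apply: flat_eflat. Qed.

Lemma syzygy_epi : exists e : {linear X (i + 1) -> M},
  (forall x, f (e x) = diff X i x) /\ (forall y, exists x, e x = y).
Proof.
have ex x : exists m, f m = diff X i x by apply/f_im; exists x.
pose e x := projT1 (cid (ex x)); have fe x : f (e x) = _ := projT2 (cid (ex x)).
have e_lin : linear e by move=> a x y; apply: f_inj; rewrite linearP !fe linearP.
exists (mk_linear e_lin); split=> [x|m]; first exact: fe.
have [x xm] : exists x, diff X i x = f m by apply/f_im; exists m.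
by exists x; apply: f_inj; rewrite -xm; apply: fe.
Qed.

Lemma syzygy_flat_resolved : flat_resolved M.
Proof.
have [e [fe e_surj]] := syzygy_epi.
pose idx k : int := iter k (fun n => n + 1) (i + 1).
exists (fun k => X (idx k)), (fun k => diff X (idx k)), e; split=> //.
- move=> x; rewrite -(testing_exact (testing_id R) x) /= -fe.
  by split=> [->|fx]; [rewrite raddf0 | apply: f_inj; rewrite fx raddf0].
- by move=> T Tt k; apply: (testing_exact Tt).
Qed.

Lemma syzygy_flat_coresolved : flat_coresolved M.
Proof.
have [e [fe e_surj]] := syzygy_epi.
(* Initially the complement and the flat kernel are both zero. *)
pose U := rows R 'I_0.
have U0 (u : U) : u = 0 by apply/ffunP => -[].
have Uflat : eflat U by apply: (eflat_retract (i := linzero U R^o) (p := linzero R^o U));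
  [move=> u; rewrite [RHS]U0 | exact: eflat_regular].
have TU0 (T : rex_functor R) (u : T U) : u = 0.
  rewrite -[LHS](@rex_id _ T U idfun) //; apply: rex_zero => x; exact: U0.
pose idx k : int := iter k (fun n => n - 1) i.
pose d k : {linear X (idx k) -> X (idx k.+1)} := cast_diff (subrK 1 (idx k)).
exists U, U, (fun k => X (idx k)), (linzero _ _), (f \o linfst M U), d.
split=> // T Tt.
(* [T e] is onto, and the kernel of [T (diff X i)] is the image of the next differential, which [e]
   kills. *)
have fmono x : rex_map T f x = 0 -> x = 0.
  have [y <-] := rex_surj e_surj x.
  rewrite (@rex_comp _ T _ _ _ e f (diff X i)) // => /(testing_exact Tt) [z <-].
  apply: rex_comp0 => w; apply: f_inj; rewrite fe raddf0; exact: diffK.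
have ex0 := @cast_diff_exact T _ _ _ (subrK 1 i) (erefl (i + 1)) Tt.
split.
- by move=> x _; apply: TU0.
- move=> w; split=> [fw|[z <-]]; last by apply: rex_comp0 => x; rewrite /= raddf0.
  exists 0; rewrite raddf0; apply: esym; apply: rex_pair_ext; last first.
    by rewrite [LHS]TU0 [RHS]TU0.
  by rewrite raddf0; apply: fmono; rewrite (@rex_comp _ T _ _ _ _ _ (f \o linfst M U)).
- move=> x; split=> [/ex0 [y <-]|[w <-]].
    exists (rex_map T (lininl M U) (rex_map T e y)).
    rewrite (@rex_comp _ T _ _ _ (lininl M U) _ f) //.
    exact: (@rex_comp _ T _ _ _ e f (diff X i)).
  rewrite -(@rex_comp _ T _ _ _ (linfst M U) f) //.
  have [y <-] := rex_surj e_surj (rex_map T (linfst M U) w).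
  rewrite (@rex_comp _ T _ _ _ e f (diff X i)) //.
  by apply/ex0; exists y.
- by move=> k; apply: cast_diff_exact.
Qed.

End Resolutions.

Lemma dependent_choice (A : Type) (Q : A -> Prop) (step : A -> A -> Prop) (x0 : A) :
  Q x0 -> (forall x, Q x -> exists y, Q y /\ step x y) ->
  exists s : nat -> A, s 0%N = x0 /\ forall k, Q (s k) /\ step (s k) (s k.+1).
Proof.
move=> Q0 ex; pose B := {x | Q x}.
have ex' (x : B) : exists y : B, step (sval x) (sval y).
  by have [y [Qy xy]] := ex _ (proj2_sig x); exists (exist _ y Qy).
pose next x := projT1 (cid (ex' x)).
pose s k := iter k next (exist _ x0 Q0 : B).
exists (fun k => sval (s k)); split=> // k; split; first exact: proj2_sig.
exact: (projT2 (cid (ex' (s k)))).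
Qed.

Section Glue.
Variables (R : pzRingType) (S X : int -> lmodType R).
Variables (b : forall i, {linear X i -> S i}).
Variables (a : forall i : int, {linear S (i + 1) -> X i}).
Hypothesis b_surj : forall i y, exists x, b i x = y.
Hypothesis ab : forall i, exact_at (a i) (b i).

Let ba i x : b i (a i x) = 0. Proof. by apply/ab; exists x. Qed.

Lemma glueK i x : (a i \o b (i + 1)) ((a (i + 1) \o b (i + 1 + 1)) x) = 0.
Proof. by rewrite /= ba raddf0. Qed.

Definition glue : complex R := @Complex R X (fun i => a i \o b (i + 1)) glueK.

(** The short exact sequences S (i + 1) -> X i -> S i stay exact under a right exact [T] that keeps
    their first maps injective. *)
Lemma glue_exact T : (forall i x, rex_map T (a i) x = 0 -> x = 0) ->
  forall i, exact_at (rex_map T (diff glue (i + 1))) (rex_map T (diff glue i)).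
Proof.
move=> a_mono i x; split=> [dx|[y <-]]; last by apply: rex_comp0 => z; apply: glueK.
have bx : rex_map T (b (i + 1)) x = 0.
  by apply: (a_mono i); rewrite (@rex_comp _ T _ _ _ (b (i + 1)) (a i) (diff glue i)).
have [s <-] : exists s, rex_map T (a (i + 1)) s = x.
  by apply/(rex_exact (@ab (i + 1)) (@b_surj (i + 1)) (r := T)).
have [y <-] := rex_surj (b_surj (i := i + 1 + 1)) s.
by exists y; apply: esym; apply: rex_comp.
Qed.

Lemma glue_hom_acyclic (Q : lmodType R) :
  (forall i (f : {linear S (i + 1) -> Q}), exists g : {linear X i -> Q},
     forall x, g (a i x) = f x) -> hom_acyclic glue Q.
Proof.
move=> a_ext i f; split=> [fd|[g gE] x]; last by rewrite -gE diffK raddf0.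
have [|h hE] := descend (f := f) (b_surj (i := i + 1)).
  move=> x /ab [s <-]; have [y <-] := b_surj s; exact: fd.
by have [g gE] := a_ext i h; exists g => x; rewrite /= gE hE.
Qed.

Lemma glue_syzygy i : injective (a i) -> is_syzygy (S (i + 1)) glue.
Proof.
move=> a_inj; exists i, (a i); split=> // y; split=> [[m <-]|[x <-]].
  by have [x <-] := b_surj m; exists x.
by exists (b (i + 1) x).
Qed.

End Glue.

(** * Splicing the two halves *)

Section Splice.
Variables (R : pzRingType).

Definition syzygy_step (A B C : lmodType R) (a : {linear A -> B}) (b : {linear B -> C}) :=
  [/\ projective_module B, forall y, exists x, b x = y, exact_at a b &
      forall T, testing T -> forall x, rex_map T a x = 0 -> x = 0].

(** One complex serves both conclusions: iterated free covers on the left, iterated preenvelopes on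
    the right. *)
Lemma fp_Gorenstein_flat_PGF (M : lmodType R) :
  finitely_presented M -> Gorenstein_flat M -> PGF M /\ Gorenstein_projective M.
Proof.
move=> /finitely_presented_presented Mfp [X0 [Xtot [i0 [f0 [f0_inj f0_im]]]]].
have Mres := syzygy_flat_resolved Xtot f0_inj f0_im.
have Mcores := syzygy_flat_coresolved Xtot f0_inj f0_im.
(* The first step to the right is separate: [M] occupies degree 0 as the start of the left sequence,
   so the iterated right sequence begins with [C0] in degree -1. *)
have [N0 [C0 [j0 [q0 [[N0proj q0_surj jq0] j0_mono j0_onto C0fp C0res]]]]] :=
  coresolved_step Mfp Mcores.
pose rstep (C C' : lmodType R) := exists (N : lmodType R) (j : {linear C -> N})
  (q : {linear N -> C'}), syzygy_step j q /\ dual_onto j.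
have [//|C [Cfp Ccores]|Cr [CrE CrP]] := @dependent_choice _
    (fun C => presented C /\ flat_coresolved C) rstep C0.
  have [N [C' [j [q [[Np qs jq] jm jo Cf Cc]]]]] := coresolved_step Cfp Ccores.
  by exists C'; split=> //; exists N, j, q.
pose lstep (K K' : lmodType R) := exists (P : lmodType R) (a : {linear K' -> P})
  (p : {linear P -> K}), syzygy_step a p.
have [//|K Kres|K [KE KP]] := @dependent_choice _ (@flat_resolved R) lstep M.
  have [p p_surj] := free_cover K.
  have [K' [a [a_inj ap]]] := ker_exists p.
  have Pp := @free_projective R K.
  have [am K'res] := flat_resolved_kernel Kres Pp p_surj a_inj ap.
  by exists K'; split=> //; exists (free_module R K), a, p.
subst M C0.
have lP k : lstep (K k) (K k.+1) by case: (KP k).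
pose P k := projT1 (cid (lP k)).
pose a k : {linear K k.+1 -> P k} := projT1 (cid (projT2 (cid (lP k)))).
pose p k : {linear P k -> K k} :=
  projT1 (cid (projT2 (cid (projT2 (cid (lP k)))))).
have apP k : syzygy_step (a k) (p k) :=
  projT2 (cid (projT2 (cid (projT2 (cid (lP k)))))).
have rP k : rstep (Cr k) (Cr k.+1) by case: (CrP k).
pose N k := projT1 (cid (rP k)).
pose j k : {linear Cr k -> N k} := projT1 (cid (projT2 (cid (rP k)))).
pose q k : {linear N k -> Cr k.+1} :=
  projT1 (cid (projT2 (cid (projT2 (cid (rP k)))))).
have jqP k : syzygy_step (j k) (q k) /\ dual_onto (j k) :=
  projT2 (cid (projT2 (cid (projT2 (cid (rP k)))))).
(* [Negz k] is -(k+1), and [X i] sits between [S (i + 1)] and [S i]. The successor [sc] computes by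
   cases, so the maps [al] can be given by matching before they are transported to [i + 1]. *)
pose S i := match i with Posz k => K k | Negz k => Cr k end.
pose X i := match i with Posz k => P k | Negz 0 => N0 | Negz k.+1 => N k end.
pose sc i :=
  match i with Posz k => Posz k.+1 | Negz 0 => Posz 0 | Negz k.+1 => Negz k end.
have scE i : sc i = i + 1.
  case: i => [k|[|k]] //=; first by rewrite -addn1 PoszD.
  by rewrite !NegzE -[k.+2]addn1 PoszD opprD subrK.
pose b i : {linear X i -> S i} :=
  match i return {linear X i -> S i} with
  | Posz k => p k | Negz 0 => q0 | Negz k.+1 => q k end.
pose al i : {linear S (sc i) -> X i} :=
  match i return {linear S (sc i) -> X i} with
  | Posz k => a k | Negz 0 => j0 | Negz k.+1 => j k end.
pose good i n (f : {linear S n -> X i}) := syzygy_step f (b i) /\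
  forall Q : lmodType R, projective_module Q -> forall h : {linear S n -> Q},
    exists g : {linear X i -> Q}, forall x, g (f x) = h x.
have al_good i : good i _ (al i).
  split.
    case: i => [k|[|k]]; [exact: apP | by split | by case: (jqP k)].
  (* Maps to [Q] extend by the vanishing of Ext on the left half and by the preenvelope property on
     the right half. *)
  move=> Q /projective_eflat Qflat; case: i => [k|[|k]] h.
  - apply: (@ext_vanishing R K P a p) => //; rewrite ?KE //.
    + by move=> n; case: (apP n).
    + by move=> n; case: (apP n).
    + by move=> n; case: (apP n).
    + by move=> n x y axy; case: (apP n) => _ _ _ am; apply/subr0_eq;
        apply: (am _ (testing_id R)); rewrite /= linearB axy subrr.
    + by move=> n J Jinj; case: (apP n) => _ _ _ am; apply: (am _ (testing_tensor Jinj)).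
  - exact: dual_onto_eflat h Mfp j0_onto Qflat.
  - by apply: dual_onto_eflat (proj2 (jqP k)) Qflat; case: (CrP k) => -[].
have [al' al'_good] : exists al' : forall i : int, {linear S (i + 1) -> X i},
    forall i, good i _ (al' i).
  exists (fun i => match scE i in _ = n return {linear S n -> X i} with
                   | erefl => al i end).
  by move=> i; case: _ / (scE i).
have Xproj i : projective_module (X i) by case: (al'_good i) => -[].
have b_surj i : forall y, exists x, b i x = y by case: (al'_good i) => -[].
have ab i : exact_at (al' i) (b i) by case: (al'_good i) => -[].
have al'_mono T : testing T -> forall i x, rex_map T (al' i) x = 0 -> x = 0.
  by move=> Tt i; case: (al'_good i) => -[_ _ _] /(_ T Tt).
pose G := glue ab.
have Gacy : acyclic G := glue_exact b_surj (ab := ab) (al'_mono _ (testing_id R)).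
have Gsyz : is_syzygy (K 0%N) G.
  apply: (glue_syzygy b_surj ab (i := Negz 0)) => x y xy.
  apply/subr0_eq/(al'_mono _ (testing_id R)); by rewrite /= linearB xy subrr.
split; exists G; split=> //.
- move=> J Jinj; exact: (glue_exact b_surj (ab := ab) (al'_mono _ (testing_tensor Jinj))).
- move=> Q Qproj; apply: (glue_hom_acyclic b_surj) => i f.
  by case: (al'_good i) => _ /(_ Q Qproj f).
Qed.

End Splice.

Theorem theoremA (R : pzRingType) (hR : Gwgldim R <> None)
    (M : lmodType R) (hfp : finitely_presented M) (hGF : Gorenstein_flat M) :
  PGF M /\ Gorenstein_projective M.
Proof. exact: fp_Gorenstein_flat_PGF. Qed.
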